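(* Let $G$ be a real Lie group and $\Lambda\subset G$ a discrete cocompact subgroup, and let $G/\Lambda$ be the compact homogenous Riemannian manifold obtained by endowing the quotient with the Riemannian metric induced by a biinvariant Riemannian metric on $G$. Then any endomorphism of $G/\Lambda$ is $h$-expansive.
   Context: A map $\phi:G/\Lambda\to G/\Lambda$ is an endomorphism of $G/\Lambda$ if there are an element $\underline{g}\in G$ and a (Lie group) morphism $\Phi:G\to G$ with $\Phi(\Lambda)\subset\Lambda$ such that $\phi(g\Lambda)=\underline{g}\,\Phi(g)\Lambda$ for all $g\in G$. For a continuous map $f$ of a compact metric space $(M,d)$: $B_n(f,x,\varepsilon)=\{y: d(f^iy,f^ix)<\varepsilon,\ 0\le i\le n-1\}$; $r_n(f,A,\delta)$ is the smallest cardinality of a set $K\subset M$ such that for every $x\in A$ there is $y\in K$ with $d(f^ix,f^iy)<\delta$ for $0\le i\le n-1$; $h^*(f,\varepsilon)=\lim_{\delta\to0}\limsup_n\frac1n\log\sup_{x\in M}r_n(f,B_n(f,x,\varepsilon),\delta)$. The map $f$ is $h$-expansive if there is $\varepsilon>0$ with $h^*(f,\varepsilon)=0$. *)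

(* Defs.v *)
From HB Require Import structures.
From mathcomp Require Import all_boot all_order all_algebra.
From mathcomp Require Import all_classical all_reals all_analysis.

Set Implicit Arguments.
Unset Strict Implicit.
Unset Printing Implicit Defensive.

Import Order.TTheory GRing.Theory Num.Theory.
Import numFieldNormedType.Exports.

Local Open Scope classical_set_scope.
Local Open Scope ring_scope.

Section smooth_manifolds.
Context {R : realType}.
Implicit Types V W : normedModType R.

(* ['D_v_1 ('D_v_2 ( ... f))]; on an open set of a finite-dimensional space,
   [f] is C^oo iff all these iterated directional derivatives exist and are
   continuous there. *)
Fixpoint iter_derive V W (vs : seq V) (f : V -> W) : V -> W :=
  if vs is v :: vs' then fun x => 'D_v (iter_derive vs' f) x else f.

Definition smooth_on V W (U : set V) (f : V -> W) : Prop :=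
  forall x, U x -> forall vs : seq V,
    {for x, continuous (iter_derive vs f)} /\
    forall v, derivable (iter_derive vs f) x v.

(* [coord i] is meaningful on [dom i], and [param i], its inverse, on
   [coord i @` dom i]. *)
Record atlas V (M : Type) := Atlas {
  chart :> Type;
  dom : chart -> set M;
  coord : chart -> M -> V;
  param : chart -> V -> M }.
Arguments dom {V M} _ _ _.
Arguments coord {V M} _ _ _.
Arguments param {V M} _ _ _.

Definition chart_image V (M : Type) (A : atlas V M) (i : A) : set V :=
  coord A i @` dom A i.
Arguments chart_image {V M} _ _ _.

Definition in_charts V W (M N : Type) (A : atlas V M) (B : atlas W N)
    (f : M -> N) (i : A) (j : B) : V -> W :=
  fun v => coord B j (f (param A i v)).

Definition smooth_in_charts V W (M N : Type) (A : atlas V M) (B : atlas W N)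
    (f : M -> N) : Prop :=
  forall (i : A) (j : B),
    smooth_on (coord A i @` (dom A i `&` f @^-1` dom B j))
              (in_charts f i j).

Record smooth_manifold V (M : topologicalType) (A : atlas V M) : Prop :=
  SmoothManifold {
  manifold_hausdorff : hausdorff_space M;
  manifold_second_countable : @second_countable M;
  chart_cover : forall x, exists i, dom A i x;
  dom_open : forall i, open (dom A i);
  chart_image_open : forall i, open (chart_image A i);
  coordK : forall i x, dom A i x -> param A i (coord A i x) = x;
  coord_continuous : forall i x, dom A i x -> {for x, continuous (coord A i)};
  param_continuous :
    forall i v, chart_image A i v -> {for v, continuous (param A i)};
  transition_smooth : smooth_in_charts A A id }.

Definition smooth_map V W (M N : topologicalType) (A : atlas V M)
    (B : atlas W N) (f : M -> N) : Prop :=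
  continuous f /\ smooth_in_charts A B f.

Definition prod_atlas V W (M N : Type) (A : atlas V M) (B : atlas W N) :
    atlas (V * W)%type (M * N)%type :=
  @Atlas (V * W)%type (M * N)%type (A * B)%type
    (fun ij => dom A ij.1 `*` dom B ij.2)
    (fun ij p => (coord A ij.1 p.1, coord B ij.2 p.2))
    (fun ij q => (param A ij.1 q.1, param B ij.2 q.2)).

End smooth_manifolds.
Arguments dom {R V M} _ _ _.
Arguments coord {R V M} _ _ _.
Arguments param {R V M} _ _ _.
Arguments chart_image {R V M} _ _ _.

Section riemannian.
Context {R : realType} {n : nat}.

Definition gram (S : 'M[R]_n) (u v : 'rV[R]_n) : R :=
  (u *m S *m v^T) 0 0.

(* Gram matrices of a (0,2)-tensor in the coordinates of each chart. *)
Definition metric_tensor (M : Type) (A : atlas 'rV[R]_n M) :=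
  A -> 'rV[R]_n -> 'M[R]_n.

(* [f^* h = g]. *)
Definition metric_preserving (M N : Type) (A : atlas 'rV[R]_n M)
    (B : atlas 'rV[R]_n N) (g : metric_tensor A) (h : metric_tensor B)
    (f : M -> N) : Prop :=
  forall (i : A) (j : B) (x : M), dom A i x -> dom B j (f x) ->
  forall u v : 'rV[R]_n,
    gram (h j (coord B j (f x))) ('D_u (in_charts f i j) (coord A i x))
                                 ('D_v (in_charts f i j) (coord A i x))
    = gram (g i (coord A i x)) u v.

Record riemannian_metric (M : Type) (A : atlas 'rV[R]_n M)
    (g : metric_tensor A) : Prop := RiemannianMetric {
  metric_smooth : forall i, smooth_on (chart_image A i) (g i);
  metric_sym : forall i v, chart_image A i v -> (g i v)^T = g i v;
  metric_pos : forall i v, chart_image A i v ->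
    forall u, u != 0 -> 0 < gram (g i v) u u;
  metric_compat : metric_preserving g g id }.

(* C^1 arcs contained in the domain of one chart. A C^1 map on [0, 1], with
   one-sided derivatives at the endpoints, is the restriction of a C^1 map on
   the line. *)
Inductive chart_arc (M : Type) (A : atlas 'rV[R]_n M) (g : metric_tensor A) :
    M -> M -> R -> Prop :=
| ChartArc (i : A) (c : R -> 'rV[R]_n) of
    (forall t, derivable c t 1) &
    continuous (derive1 c) &
    (forall t, t \in `[0, 1] -> chart_image A i (c t)) :
    chart_arc g (param A i (c 0)) (param A i (c 1))
      (\int[lebesgue_measure]_(t in `[0, 1])
         Num.sqrt (gram (g i (c t)) (derive1 c t) (derive1 c t))).

(* Every piecewise C^1 path is, up to reparametrization, a finite
   concatenation of such arcs. *)
Inductive path_length (M : Type) (A : atlas 'rV[R]_n M) (g : metric_tensor A) :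
    M -> M -> R -> Prop :=
| PathNil x : path_length g x x 0
| PathCons x y z l l' of chart_arc g x y l & path_length g y z l' :
    path_length g x z (l + l').

(* Equal to [+oo] between points of different connected components. *)
Definition riemannian_dist (M : Type) (A : atlas 'rV[R]_n M)
    (g : metric_tensor A) (x y : M) : \bar R :=
  ereal_inf [set l%:E | l in path_length g x y].

End riemannian.

(* The group operations are not required to be continuous here: this is part
   of [lie_group]. *)
#[short(type="groupTopologicalType")]
HB.structure Definition GroupTopological := {G of Group G & Topological G}.

Section lie_groups.
Local Open Scope group_scope.
Context {R : realType} {n : nat} {G : groupTopologicalType}.
Implicit Types (A : atlas 'rV[R]_n G) (L : groupClosed G).

Definition lie_group A : Prop :=
  [/\ smooth_manifold A,
      smooth_map (prod_atlas A A) A (fun p => p.1 * p.2) &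
      smooth_map A A (fun x => x^-1)].

Definition biinvariant A (g : metric_tensor A) : Prop :=
  forall a : G, metric_preserving g g (fun x => a * x) /\
                metric_preserving g g (fun x => x * a).

Definition discrete_subgroup L : Prop := [set` L] `<=` isolated [set` L].

End lie_groups.

Section coset_space.
Local Open Scope group_scope.
Local Open Scope quotient_scope.
Context {G : groupTopologicalType} (L : groupClosed G).

Definition same_coset (x y : G) : bool := x^-1 * y \in L.

Lemma same_coset_refl : reflexive same_coset.
Proof. by move=> x; rewrite /same_coset mulVg gpred1. Qed.

Lemma same_coset_sym : symmetric same_coset.
Proof. by move=> x y; rewrite /same_coset -gpredV invgM invgK. Qed.

Lemma same_coset_trans : transitive same_coset.
Proof.
by move=> y x z xy yz; rewrite /same_coset -(mulVKg y z) mulgA gpredM.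
Qed.

Definition coset_equiv :=
  EquivRel same_coset same_coset_refl same_coset_sym same_coset_trans.

(* The set of left cosets [x L]. *)
Definition coset_space := quotient_topology {eq_quot coset_equiv}.

HB.instance Definition _ := Topological.on coset_space.
HB.instance Definition _ := Quotient.on coset_space.

Definition coset_pi (x : G) : coset_space := \pi_coset_space x.

Lemma coset_piP (x y : G) : coset_pi x = coset_pi y <-> x^-1 * y \in L.
Proof. by split=> [/eqmodP //|xy]; apply/eqmodP. Qed.

End coset_space.

Section quotient_manifold.
Local Open Scope group_scope.
Context {R : realType} {n : nat} {G : groupTopologicalType}.
Context (A : atlas 'rV[R]_n G) (L : groupClosed G).

Record quotient_chart := QuotientChart {
  qchart : A;
  qdom : set G;
  qdom_open : open qdom;
  qdom_sub : qdom `<=` dom A qchart;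
  qdom_inj : forall x y, qdom x -> qdom y ->
    coset_pi L x = coset_pi L y -> x = y }.

Definition qsection (i : quotient_chart) (q : coset_space L) : G :=
  xget 1 [set x | qdom i x /\ coset_pi L x = q].

(* The smooth structure on [G / L] making [coset_pi L] a local
   diffeomorphism. *)
Definition quotient_atlas : atlas 'rV[R]_n (coset_space L) :=
  @Atlas R 'rV[R]_n (coset_space L) quotient_chart
    (fun i => coset_pi L @` qdom i)
    (fun i q => coord A (qchart i) (qsection i q))
    (fun i v => coset_pi L (param A (qchart i) v)).

(* The metric on [G / L] making [coset_pi L] a local isometry; independent of
   the choice of local sections when [g] is invariant under right
   translations by [L]. *)
Definition quotient_metric (g : metric_tensor A) :
    metric_tensor quotient_atlas :=
  fun i => g (qchart i).

Definition quotient_endomorphism (phi : coset_space L -> coset_space L) :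
    Prop :=
  exists (a : G) (Phi : {multiplicative G -> G}),
    [/\ smooth_map A A Phi,
        (forall x, x \in L -> Phi x \in L) &
        forall x, phi (coset_pi L x) = coset_pi L (a * Phi x)].

End quotient_manifold.
Arguments quotient_atlas {R n G} A L.
Arguments quotient_metric {R n G A} L g.

Section h_expansiveness.
Local Open Scope ereal_scope.
Context {R : realType} {M : Type} (d : M -> M -> \bar R) (f : M -> M).

Definition bowen_ball (n : nat) (x : M) (eps : R) : set M :=
  [set y | forall i, (i < n)%N -> d (iter i f y) (iter i f x) < eps%:E].

Definition spanning (n : nat) (A : set M) (delta : R) (K : set M) : Prop :=
  forall x, A x -> exists2 y, K y &
    forall i, (i < n)%N -> d (iter i f x) (iter i f y) < delta%:E.

(* Equal to [+oo] if there is no finite spanning set. *)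
Definition spanning_number (n : nat) (A : set M) (delta : R) : \bar R :=
  ereal_inf [set k%:R%:E | k in
    [set k : nat | exists2 K : set M, (K #= `I_k)%card & spanning n A delta K]].

Definition local_entropy_at (eps delta : R) : \bar R :=
  limn_esup (fun n : nat => (n%:R^-1)%:E *
    lne (ereal_sup
      [set spanning_number n (bowen_ball n x eps) delta | x in [set: M]])).

Lemma spanning_number_noninc (n : nat) (A : set M) (a b : R) :
  (a <= b)%R -> spanning_number n A b <= spanning_number n A a.
Proof.
move=> ab; apply: ereal_inf_le_tmp => _ [k [K Kk sK] <-].
exists k => //; exists K => // x /sK[y Ky xy]; exists y => // i /xy.
by move=> /lt_le_trans; apply; rewrite lee_fin.
Qed.

Lemma local_entropy_at_noninc (eps a b : R) :
  (a <= b)%R -> local_entropy_at eps b <= local_entropy_at eps a.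
Proof.
move=> ab; rewrite /local_entropy_at !limn_esup_lim.
apply: lee_lim; [exact: is_cvg_esups|exact: is_cvg_esups|].
apply: nearW => m; apply: ge_ereal_sup => _ /= [n mn <-].
apply: le_trans; last by apply: ereal_sup_ubound; exists n.
apply: lee_wpmul2l; first by rewrite lee_fin invr_ge0.
set s := ereal_sup _; set t := ereal_sup _.
have st : s <= t.
  apply: ge_ereal_sup => _ [x _ <-]; apply: le_trans; last first.
    by apply: ereal_sup_ubound; exists x.
  exact: spanning_number_noninc.
have [s0|s0] := leP s 0; first by rewrite le0_lneNy// leNye.
by rewrite lee_lne// in_itv/= leey andbT ltW// (lt_le_trans s0).
Qed.

Lemma is_cvg_local_entropy_at (eps : R) :
  cvg (local_entropy_at eps delta @[delta --> 0^'+]).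
Proof.
apply: nonincreasing_at_right_is_cvge; apply: nearW => x a b _ _.
exact: local_entropy_at_noninc.
Qed.

Definition local_entropy (eps : R) : \bar R :=
  lim (local_entropy_at eps delta @[delta --> 0^'+]).

Definition h_expansive : Prop :=
  exists2 eps : R, (0 < eps)%R & local_entropy eps = 0.

End h_expansiveness.

(* Main.v *)
Require Import Defs.
From HB Require Import structures.
From mathcomp Require Import all_boot all_order all_algebra.
From mathcomp Require Import all_classical all_reals all_analysis.
From mathcomp Require Import ring lra.
(* A second import, so that [coord] and [coord_continuous] are those of atlases. *)
Require Import Defs.

Set Implicit Arguments.
Unset Strict Implicit.
Unset Printing Implicit Defensive.

Import Order.TTheory GRing.Theory Num.Theory.
Import numFieldNormedType.Exports.

Local Open Scope classical_set_scope.
Local Open Scope ring_scope.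

(** Write [pi : G -> G / L], [phi (pi p) = pi (a Phi(p))] and
[psi h = a Phi(h) a^-1], an endomorphism of [G]. Since
[a Phi(h p) = psi(h) (a Phi(p))], one has
[phi^i (pi (h p)) = pi (psi^i(h) p_i)] where [p_i] is the [i]-th iterate of [p]
under [p |-> a Phi(p)]. Uniformly in [p], the distance from [pi (h p)] to
[pi p] is small when [h] is near 1 ([quotient_dist_upper_bound]); conversely
every point close to [pi p] is [pi (h p)] for some [h] near 1
([quotient_dist_lower_bound]), and that small [h] is unique
([coset_pi_inj_near]). Hence, for a small radius, the Bowen ball of length [t]
about [pi p] is contained in the image, under [h |-> pi (h p)], of
[{h | psi^i(h) is eps-close to 1 for i < t}] ([bowen_nbhd]), and it is enough to
cover this set by boundedly many right translates of its analogue for a smaller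
radius, the bound being independent of [t] ([bowen_nbhd_cover]). The spanning
numbers are then bounded in [t] and all the local entropies vanish
([local_entropy_eq0]).

If [psi] were a linear map and [G] a vector space, the sets [bowen_nbhd] would
be balls of a norm depending on [t], and comparing volumes would give a bound
depending only on the dimension and on the ratio of the radii. The same argument
is carried out here with neither an exponential map nor a Haar measure.

- Volume is replaced by the size of a maximal [eta]-separated family, measured
  in a chart at 1, with [eta] much smaller than all radii in sight. Changing
  [eta] by a factor costs only a dimensional constant ([packs_coarsen]).
- Multiplication in a chart is close to addition, with a Lipschitz error
  ([mul_near_linear]), so right translations almost preserve separation.
- Homotheties are replaced by squaring. Near 1, each element has a square root
  of norm at most 4/7 of its own, and [psi] commutes with squaring; so the set
  of radius [s] consists of squares of elements of the set of radius [4 s / 7]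
  ([bowen_sqrt]). As squaring is Lipschitz, passing from radius [s] to radius
  [4 s / 7] divides the size of maximal families by at most a dimensional
  constant ([packs_halve]).

The comparison of the Riemannian distance with the topology is elementary in one
direction, a segment in a chart being a short path. In the other direction, a
bump function supported near [p] is Lipschitz for the distance
([lipschitz_bump]), because its derivative along a curve is bounded by the speed;
right invariance of the metric makes the speed computable in any chart of the
quotient. Uniformity in [p] comes from the compactness of [G / L]
([compact_coset_uniform]). *)

(** * Strict differentiability of C1 maps *)

Section strict_differentiability.
Context {R : realType}.
Implicit Types V : normedModType R.

Lemma is_derive_line V (f : V -> R) (y v : V) (s : R) :
  derivable f (y + s *: v) v ->
  is_derive s (1 : R) (fun s : R => f (y + s *: v)) ('D_v f (y + s *: v)).
Proof.
have E : (fun h : R => h^-1 *: (((fun s : R => f (y + s *: v)) \o shift s) (h *: 1)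
            - f (y + s *: v))) =
         (fun h => h^-1 *: ((f \o shift (y + s *: v)) (h *: v) - f (y + s *: v))).
  apply/funext => h /=; congr (_ *: (f _ - _)).
  by rewrite [h *: 1]mulr1 scalerDl addrCA.
by move=> fyv; split; rewrite /derivable /derive E.
Qed.

(** The mean value theorem applied to [s |-> f (y + s *: v) - s * a]. *)
Lemma line_increment V (f : V -> R) (y v : V) (t a eta : R) :
  (forall s : R, `|s| <= `|t| -> derivable f (y + s *: v) v) ->
  (forall s : R, `|s| <= `|t| -> `|'D_v f (y + s *: v) - a| <= eta) ->
  `|f (y + t *: v) - f y - t * a| <= eta * `|t|.
Proof.
move=> df Df; set F := fun s : R => f (y + s *: v).
have dF s : `|s| <= `|t| -> is_derive s (1 : R) F ('D_v f (y + s *: v)).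
  by move=> /df; exact: is_derive_line.
have cF (c d : R) : `|c| <= `|t| -> `|d| <= `|t| -> {within `[c, d], continuous F}.
  move=> ct dt; apply: derivable_within_continuous => s; rewrite in_itv/= => scd.
  apply: ex_derive; apply: dF; move: ct dt; rewrite !ler_norml; lra.
have -> : f y = F 0 by rewrite /F scale0r addr0.
rewrite -/(F t).
have [t0|t0|->] := ltgtP t 0; last first.
- by rewrite subrr mul0r subrr normr0 mulr0.
- have st s : s \in `]0, t[ -> `|s| <= `|t|.
    by rewrite in_itv/= => st; rewrite !gtr0_norm; lra.
  have [s /st/dF//||c /st ct ->] := @MVT _ F (fun s => 'D_v f (y + s *: v)) 0 t t0.
    by apply: cF; rewrite ?normr0.
  rewrite subr0 mulrC -mulrBr normrM mulrC.
  by rewrite ler_wpM2r//; exact: Df.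
- have st s : s \in `]t, 0[ -> `|s| <= `|t|.
    by rewrite in_itv/= => st; rewrite !ltr0_norm; lra.
  have [s /st/dF//||c /st ct E] := @MVT _ F (fun s => 'D_v f (y + s *: v)) t 0 t0.
    by apply: cF; rewrite ?normr0.
  have -> : F t - F 0 - t * a = t * ('D_v f (y + c *: v) - a) by lra.
  rewrite normrM mulrC.
  by rewrite ler_wpM2r//; apply: Df.
Qed.

(** Going from [y] to the endpoint one direction at a time, each step costs an
    error proportional to its length. All intermediate points stay within
    [size r * tau] of [y], which is why that quantity is kept below [rho]. *)
Lemma increment_sum V (I : Type) (vs : I -> V) (r : seq I) (f : V -> R) (x : V)
    (a : I -> R) (rho eta : R) (t : I -> R) (tau : R) (y : V) :
  (forall k, `|vs k| <= 1) -> (forall k, `|t k| <= tau) ->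
  (forall k z, `|z - x| < rho -> derivable f z (vs k)) ->
  (forall k z, `|z - x| < rho -> `|'D_(vs k) f z - a k| <= eta) ->
  `|y - x| + (size r)%:R * tau < rho ->
  `|f (y + \sum_(k <- r) t k *: vs k) - f y - \sum_(k <- r) t k * a k|
     <= eta * ((size r)%:R * tau).
Proof.
move=> vs1 ttau df Df; elim: r y => [|k r IH] y /=.
  by move=> _; rewrite !big_nil addr0 subr0 subrr normr0 mul0r mulr0.
rewrite -natr1 mulrDl mul1r => yrho.
have tau0 : 0 <= tau by apply: le_trans (ttau k).
have rtau0 : 0 <= (size r)%:R * tau by rewrite mulr_ge0.
have near_line s : `|s| <= `|t k| -> `|(y + s *: vs k) - x| <= `|y - x| + tau.
  move=> st; rewrite addrAC (le_trans (ler_normD _ _))// lerD2l normrZ.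
  by rewrite (le_trans _ (ttau k))// (le_trans _ st)// ler_piMr.
have H1 : `|f (y + t k *: vs k) - f y - t k * a k| <= eta * tau.
  have eta0 : 0 <= eta.
    apply: le_trans (Df k x _) => //; rewrite subrr normr0.
    by apply: le_lt_trans yrho; rewrite !addr_ge0.
  apply: le_trans (ler_wpM2l eta0 (ttau k)).
  apply: line_increment => s /near_line sx; [apply: df|apply: Df];
  by apply: le_lt_trans sx _; lra.
have := IH (y + t k *: vs k); move: H1; rewrite !big_cons addrA.
move=> H1 IHk; have {IHk}H2 := IHk ltac:(have := near_line _ (lexx _); lra).
set A := \sum_(_ <- _) t _ * _ in H2 *; set B := f (_ + _ + _) in H2 *.
have -> : B - f y - (t k * a k + A) =
  (f (y + t k *: vs k) - f y - t k * a k) + (B - f (y + t k *: vs k) - A).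
  by lra.
by apply: (le_trans (ler_normD _ _)); rewrite mulrDr [leRHS]addrC lerD.
Qed.


(** Continuity of the partial derivatives at [x] only makes the increments
    linear up to a small Lipschitz error, uniformly in both endpoints. This strict
    form, rather than differentiability at [x], is what gives contraction and
    Lipschitz estimates later on. *)
Lemma strict_derivative_scalar V (I : finType) (vs : I -> V) (cs : I -> V -> R)
    (f : V -> R) (x : V) :
  (forall k, `|vs k| <= 1) -> (forall k v, `|cs k v| <= `|v|) ->
  (forall v, v = \sum_k cs k v *: vs k) ->
  (\forall z \near x, forall k, derivable f z (vs k)) ->
  (forall k, {for x, continuous ('D_(vs k) f)}) ->
  forall eta, 0 < eta -> exists2 rho, 0 < rho & forall y z,
    `|y - x| < rho -> `|z - x| < rho ->
    `|f z - f y - \sum_k cs k (z - y) * 'D_(vs k) f x| <= eta * `|z - y|.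
Proof.
move=> vs1 cs1 csK df cDf eta eta0.
set N := (size (index_enum I))%:R : R.
have N0 : 0 <= N by rewrite ler0n.
have : \forall z \near x, forall k,
    derivable f z (vs k) /\ `|'D_(vs k) f z - 'D_(vs k) f x| <= eta / (N + 1).
  have : \forall z \near x, forall k, `|'D_(vs k) f z - 'D_(vs k) f x| <= eta / (N + 1).
    apply: filter_forall => k; have /cvgrPdist_le := cDf k.
    move=> /(_ (eta / (N + 1)) (divr_gt0 eta0 (ltr_wpDl N0 ltr01))).
    by apply: filterS => z; rewrite distrC.
  by apply: filterS2 df => z dz Dz k.
move=> /nbhs_normP[rho /= rho0 Hrho].
exists (rho / (1 + 2 * N)); first by rewrite divr_gt0//; lra.
move=> y z yx zx.
have zy : `|z - y| < rho / (1 + 2 * N) + rho / (1 + 2 * N).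
  rewrite -(subrKA x) (le_lt_trans (ler_normD _ _))// ltrD//.
  by rewrite distrC.
have Hz w : `|w - x| < rho -> forall k, derivable f w (vs k) /\
    `|'D_(vs k) f w - 'D_(vs k) f x| <= eta / (N + 1).
  by move=> wx; apply: Hrho; rewrite /= /ball_ distrC.
have := @increment_sum V I vs (index_enum I) f x (fun k => 'D_(vs k) f x) rho
  (eta / (N + 1)) (fun k => cs k (z - y)) `|z - y| y vs1 (fun k => cs1 k _)
  (fun k w wx => (Hz w wx k).1) (fun k w wx => (Hz w wx k).2).
rewrite /= -(csK (z - y)) [y + (z - y)]addrC subrK -/N => H; apply: le_trans (H _) _.
  have : N * `|z - y| <= N * (rho / (1 + 2 * N) + rho / (1 + 2 * N)).
    by rewrite ler_wpM2l// ltW.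
  have E : rho = rho / (1 + 2 * N) + N * (rho / (1 + 2 * N) + rho / (1 + 2 * N)).
    by field; lra.
  by move=> ?; rewrite [ltRHS]E ltr_leD.
rewrite mulrA ler_wpM2r// -mulrA ler_piMr ?(ltW eta0)//.
by rewrite mulrC ler_pdivrMr; lra.
Qed.

Lemma rV_norm_le q (v : 'rV[R]_q) (c : R) :
  0 <= c -> (forall j, `|v 0 j| <= c) -> `|v| <= c.
Proof.
move=> c0 vc; rewrite /Num.Def.normr/= mx_normrE.
by apply: bigmax_le => // -[i j] _ /=; rewrite (ord1 i).
Qed.

Lemma coord_norm_le q (v : 'rV[R]_q) j : `|v 0 j| <= `|v|.
Proof.
rewrite [leRHS]/Num.Def.normr/= mx_normrE.
exact: (le_bigmax _ (fun i : 'I_1 * 'I_q => `|v i.1 i.2|) (0, j)).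
Qed.

Lemma strict_derivative V (I : finType) (vs : I -> V) (cs : I -> V -> R) q
    (f : V -> 'rV[R]_q) (x : V) :
  (forall k, `|vs k| <= 1) -> (forall k v, `|cs k v| <= `|v|) ->
  (forall v, v = \sum_k cs k v *: vs k) ->
  (\forall z \near x, forall k, derivable f z (vs k)) ->
  (forall k, {for x, continuous ('D_(vs k) f)}) ->
  forall eta, 0 < eta -> exists2 rho, 0 < rho & forall y z,
    `|y - x| < rho -> `|z - x| < rho ->
    `|f z - f y - \sum_k cs k (z - y) *: 'D_(vs k) f x| <= eta * `|z - y|.
Proof.
move=> vs1 cs1 csK df cDf eta eta0.
have coordD z k j : derivable f z (vs k) ->
    'D_(vs k) (fun w => f w 0 j) z = ('D_(vs k) f z) 0 j.
  by move=> fz; rewrite derive_mx// mxE.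
have H j : \forall rho \near 0^'+, forall y z,
    `|y - x| < rho -> `|z - x| < rho ->
    `|f z 0 j - f y 0 j - \sum_k cs k (z - y) * 'D_(vs k) (fun w => f w 0 j) x|
       <= eta * `|z - y|.
  have [||rho rho0 Hrho] := @strict_derivative_scalar V I vs cs (fun w => f w 0 j) x
    vs1 cs1 csK _ _ eta eta0.
  - by apply: filterS df => z dz k; exact: (derivable_mxP _ _ _).1.
  - move=> k; have dfx := nbhs_singleton df.
    rewrite /prop_for /continuous_at coordD//.
    have Dj : ('D_(vs k) f z) 0 j @[z --> x] --> ('D_(vs k) f x) 0 j.
      exact: (cvg_comp _ (fun v : 'rV[R]_q => v 0 j) (cDf k)
        (@matrix_normedtype.coord_continuous _ _ _ 0 j _)).
    apply: cvg_trans Dj; apply: near_eq_cvg.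
    by apply: filterS df => z dz; rewrite coordD.
  near=> r => y z yr zr; apply: Hrho; [apply: lt_le_trans yr _|apply: lt_le_trans zr _];
  by near: r; exact: nbhs_right_le.
have : \forall rho \near 0^'+, forall j, forall y z,
    `|y - x| < rho -> `|z - x| < rho ->
    `|f z 0 j - f y 0 j - \sum_k cs k (z - y) * 'D_(vs k) (fun w => f w 0 j) x|
       <= eta * `|z - y|.
  exact: filter_forall.
move=> {}H; near (0 : R)^'+ => rho; exists rho => [//|y z yr zr].
apply: rV_norm_le => [|j]; first by rewrite mulr_ge0 ?(ltW eta0).
rewrite !mxE summxE; under eq_bigr do rewrite mxE.
have dfx := nbhs_singleton df.
by under eq_bigr do rewrite -coordD//; apply: (near H rho _).
Unshelve. all: by end_near. Qed.

End strict_differentiability.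

(** * Separated families in R^n *)

Section packing.
Context {R : realType} {n : nat} {T : Type}.
Implicit Types (u : T -> 'rV[R]_n) (U : set T).

(** Families are indexed by ordinals, so that their size is part of the
    statement and no bound on it has to be assumed. *)
Definition packs u (eta : R) U (N : nat) :=
  exists x : 'I_N -> T, (forall i, U (x i)) /\
    forall i j, i != j -> eta <= `|u (x i) - u (x j)|.

Lemma packs_finset u eta U (I : finType) (A : {set I}) (x : I -> T) :
  (forall i, i \in A -> U (x i)) ->
  (forall i j, i \in A -> j \in A -> i != j -> eta <= `|u (x i) - u (x j)|) ->
  packs u eta U #|A|.
Proof.
move=> Ux sep; exists (fun k => x (enum_val k)); split => [k|k l kl].
  exact/Ux/enum_valP.
by apply: sep; rewrite ?enum_valP// (inj_eq enum_val_inj).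
Qed.

Lemma pigeonhole (I C : finType) (f : I -> C) : (0 < #|C|)%N ->
  exists c, (#|I| <= #|C| * #|[set i | f i == c]%SET|)%N.
Proof.
move=> C0; have [c Hc] := @bigop.eq_bigmax C (fun c => #|[set i | f i == c]%SET|) C0.
exists c; rewrite -[leqLHS]sum1_card (partition_big f predT)//= -Hc -sum_nat_const.
apply: leq_sum => d _; rewrite sum1dep_card.
exact: (@bigop.leq_bigmax C (fun c => #|[set i | f i == c]%SET|)).
Qed.

Lemma rV_norm_ge q (v : 'rV[R]_q) (c : R) : 0 < c -> c <= `|v| ->
  exists j, c <= `|v 0 j|.
Proof.
move=> c0 cv; apply: contrapT => /forallNP H.
suff : `|v| < c by rewrite ltNge cv.
rewrite /Num.Def.normr/= mx_normrE; apply: bigmax_lt => // -[i j] _ /=.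
by rewrite (ord1 i) ltNge; apply/negP.
Qed.

(** Cut space into cubes of side [eta]: a cube contains at most one point of the
    family. Colour the cubes by their integer coordinates modulo [K + 1]. Two
    points of the same colour are at least [K + 1] cubes apart in some coordinate,
    hence [K * eta] apart, and some colour is used by a fraction at least
    [1 / (K + 1) ^ n] of the points. *)
Lemma packs_coarsen u eta U N (K : nat) : 0 < eta -> packs u eta U N ->
  exists N', packs u (K%:R * eta) U N' /\ (N <= K.+1 ^ n * N')%N.
Proof.
move=> eta0 [x [Ux sep]].
pose z i k : int := Num.floor (u (x i) 0 k / eta).
pose col i : {ffun 'I_n -> 'I_K.+1} := [ffun k => inord (absz (z i k %% K.+1)%Z)].
have [c Hc] : exists c, (#|'I_N| <= #|{ffun 'I_n -> 'I_K.+1}| * #|[set i | col i == c]%SET|)%N.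
  apply: pigeonhole; apply/card_gt0P; by exists [ffun=> ord0].
exists #|[set i | col i == c]%SET|; split; last first.
  by move: Hc; rewrite card_ffun !card_ord.
apply: (@packs_finset u _ U _ _ x) => // i j; rewrite !inE => /eqP ci /eqP cj ij.
have [k] := rV_norm_ge eta0 (sep i j ij); rewrite !mxE => uk.
apply: le_trans (coord_norm_le _ k); rewrite !mxE.
have zij : z i k != z j k.
  apply: contraTneq uk => zk; rewrite -ltNge.
  have [/andP[a1 a2] /andP[b1 b2]] :=
    (floor_itv (u (x i) 0 k / eta), floor_itv (u (x j) 0 k / eta)).
  move: a1 a2 b1 b2; rewrite -/(z i k) -/(z j k) zk.
  rewrite !ler_pdivlMr// !ltr_pdivrMr// => a1 a2 b1 b2.
  by rewrite ltr_norml; move: a1 a2 b1 b2; rewrite intrD mulrDl mul1r; lra.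
have zmod : (z i k = z j k %[mod K.+1])%Z.
  have m i' : (0 <= z i' k %% K.+1)%Z by rewrite modz_ge0.
  have mlt i' : (absz (z i' k %% K.+1)%Z < K.+1)%N.
    by rewrite -ltz_nat gez0_abs// ltz_pmod.
  move: ci; rewrite -cj => /ffunP/(_ k); rewrite !ffunE => /(congr1 val).
  by rewrite /= !inordK// => /(congr1 Posz); rewrite !gez0_abs.
have : (K.+1 %| z i k - z j k)%Z by rewrite -eqz_mod_dvd; apply/eqP.
move=> /dvdzP[d dE].
have d0 : d != 0 by apply: contraNneq zij => d0; rewrite -subr_eq0 dE d0 mul0r.
have zE : (z i k)%:~R = (z j k)%:~R + d%:~R * (K%:R + 1) :> R.
  by rewrite natr1 -[K.+1%:R]/(K.+1%:Z%:~R) -intrM -intrD -dE addrC subrK.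
have [/andP[a1 a2] /andP[b1 b2]] :=
    (floor_itv (u (x i) 0 k / eta), floor_itv (u (x j) 0 k / eta)).
move: a1 a2 b1 b2; rewrite -/(z i k) -/(z j k) !intrD zE.
rewrite !ler_pdivlMr// !ltr_pdivrMr// => a1 a2 b1 b2.
have K0 : 0 <= K%:R * eta by rewrite mulr_ge0// ltW.
have : 1 <= `|d%:~R : R| by rewrite -intr_norm -[1]/(1%:~R) ler_int -gtz0_ge1 normr_gt0.
have [d1|d1] := leP 0 (d%:~R : R).
  rewrite ger0_norm// => d1'; rewrite ler_normr; apply/orP; left.
  have : K%:R * eta + eta <= d%:~R * (K%:R * eta + eta).
    by rewrite ler_peMl// addr_ge0// ltW.
  by lra.
rewrite ltr0_norm// => d1'; rewrite ler_normr; apply/orP; right.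
have : K%:R * eta + eta <= (- d%:~R) * (K%:R * eta + eta).
  by rewrite ler_peMl// addr_ge0// ltW.
by lra.
Qed.

(** Coarsen until the separation exceeds the diameter of the set: only one point
    can survive. *)
Lemma packs_bounded u eta U (r : R) : 0 < eta -> (forall x, U x -> `|u x| <= r) ->
  exists D, forall N, packs u eta U N -> (N <= D)%N.
Proof.
move=> eta0 Ur; set K := Num.truncn (2 * r / eta).
exists (K.+2 ^ n)%N => N /(packs_coarsen K.+1 eta0)[N' [[x [Ux sep]] NN']].
apply: (leq_trans NN'); rewrite -[leqRHS]muln1 leq_mul2l; apply/orP; right.
rewrite leqNgt; apply/negP => N'1.
have := sep (Ordinal (ltnW N'1)) (Ordinal N'1) isT.
apply/negP; rewrite -ltNge.
apply: (@le_lt_trans _ _ (2 * r)).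
  rewrite (le_trans (ler_normB _ _))//.
  by have := Ur _ (Ux (Ordinal N'1)); have := Ur _ (Ux (Ordinal (ltnW N'1))); lra.
rewrite -ltr_pdivrMr//; apply: truncnS_gt.
Qed.

End packing.

(** * Bowen neighbourhoods of the identity for an endomorphism *)

Section local_dynamics.
Context {R : realType} {n : nat} {G : groupTopologicalType}.
Implicit Types (D : set G) (u : G -> 'rV[R]_n).

Definition coord_ball D u (r : R) : set G := [set h | D h /\ `|u h| < r].

(** The properties of a chart [u] at 1 which replace the exponential map:
    multiplication is addition up to a small Lipschitz error, and small elements
    have small square roots. *)
Record near_linear_coords D u (r : R) : Prop := NearLinearCoords {
  nlc_radius : 0 < r;
  nlc_one : u 1%g = 0;
  nlc_nbhs : forall e, 0 < e -> nbhs (1%g : G) (coord_ball D u e);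
  nlc_base : forall U, nbhs (1%g : G) U -> exists2 e, 0 < e & coord_ball D u e `<=` U;
  nlc_mul_dom : forall h k, coord_ball D u r h -> coord_ball D u r k -> D (h * k)%g;
  nlc_mul : forall h h' k k',
    coord_ball D u r h -> coord_ball D u r h' ->
    coord_ball D u r k -> coord_ball D u r k' ->
    `|u (h * k)%g - u (h' * k')%g - ((u h - u h') + (u k - u k'))|
      <= 8^-1 * (`|u h - u h'| + `|u k - u k'|);
  nlc_sqrt : forall h, coord_ball D u r h ->
    exists2 k, coord_ball D u r k & (k * k)%g = h }.

Definition bowen_nbhd (psi : G -> G) D u (t : nat) (r : R) : set G :=
  [set h | forall i, (i < t)%N -> coord_ball D u r (iter i psi h)].

Variables (D : set G) (u : G -> 'rV[R]_n) (r : R).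
Hypothesis lc : near_linear_coords D u r.
Variable psi : G -> G.
Hypothesis psiM : {morph psi : x y / (x * y)%g}.
Hypothesis cpsi : {for 1%g, continuous psi}.
Variable eps : R.
Hypothesis eps0 : 0 < eps.
Hypothesis eps_r : 4 * eps <= r.
Hypothesis eps_psi : forall h, coord_ball D u (4 * eps) h -> coord_ball D u r (psi h).
Hypothesis eps_inv : forall h, coord_ball D u (4 * eps) h -> coord_ball D u r h^-1%g.

Local Notation B := (coord_ball D u).
Local Notation W := (bowen_nbhd psi D u).

Let ball_mono a b : a <= b -> B a `<=` B b.
Proof. by move=> ab h [Dh uh]; split=> //; exact: lt_le_trans ab. Qed.

Let W_mono t a b : a <= b -> W t a `<=` W t b.
Proof. by move=> ab h Wh i it; apply: (ball_mono ab); exact: Wh. Qed.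

Let psi1 : psi 1%g = 1%g.
Proof. by apply: (mulgI (psi 1%g)); rewrite -psiM !mulg1. Qed.

Let ball1 e : 0 < e -> B e 1%g.
Proof. by move=> e0; exact: nbhs_singleton (nlc_nbhs lc e0). Qed.

Let iterM i : {morph iter i psi : x y / (x * y)%g}.
Proof. by elim: i => [//|i IH] x y /=; rewrite IH psiM. Qed.

Let iter1 i : iter i psi 1%g = 1%g.
Proof. by elim: i => [//|i /= ->]. Qed.

Let iterV i x : iter i psi x^-1%g = ((iter i psi x)^-1)%g.
Proof. by apply: (mulgI (iter i psi x)); rewrite -iterM !mulgV iter1. Qed.

Let W1 t e : 0 < e -> W t e 1%g.
Proof. by move=> e0 i _; rewrite iter1; exact: ball1. Qed.

Let norm_mul a b h k : a <= r -> b <= r -> B a h -> B b k ->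
  B (9 / 8 * (a + b)) (h * k)%g.
Proof.
move=> ar br Bh Bk.
have [Bh' Bk'] := (ball_mono ar Bh, ball_mono br Bk).
have B1 := ball1 (nlc_radius lc).
split; first exact: nlc_mul_dom lc _ _ Bh' Bk'.
have := nlc_mul lc Bh' B1 Bk' B1; rewrite mulg1 (nlc_one lc) !subr0.
have := ler_distD (u h + u k) (u (h * k)%g) 0; rewrite !subr0.
have := ler_normD (u h) (u k); case: Bh => _; case: Bk => _; lra.
Qed.

Let norm_inv a h : a <= 4 * eps -> B a h -> B (2 * a) h^-1%g.
Proof.
move=> ae Bh; have Bh4 := ball_mono ae Bh.
have Bh' := ball_mono eps_r Bh4; have Bi := eps_inv Bh4.
have B1 := ball1 (nlc_radius lc).
split; first by case: Bi.
have := nlc_mul lc Bh' B1 Bi B1; rewrite mulg1 mulgV (nlc_one lc) !subr0 add0r normrN.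
have := ler_normB (u h + u h^-1%g) (u h); rewrite [_ + u h^-1%g]addrC addrK.
by case: Bh => _; have := normr_ge0 (u h); lra.
Qed.

(** Squaring is [h |-> 2 h] up to a relative error 1/4, and [4 / 7] is the inverse
    of [2 - 1 / 4]. *)
Let sqr_lower k : B r k -> `|u k| <= 4 / 7 * `|u (k * k)%g|.
Proof.
move=> Bk; have B1 := ball1 (nlc_radius lc).
have := nlc_mul lc Bk B1 Bk B1; rewrite mulg1 (nlc_one lc) !subr0.
have := ler_distD (u (k * k)%g) (u k + u k) 0; rewrite !subr0.
have -> : `|u k + u k| = 2 * `|u k| by rewrite -mulr2n normrMn mulr_natl.
by rewrite distrC; lra.
Qed.

Let sqr_upper h k : B r h -> B r k ->
  `|u (h * h)%g - u (k * k)%g| <= 3 * `|u h - u k|.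
Proof.
move=> Bh Bk; have := nlc_mul lc Bh Bk Bh Bk.
have := ler_distD ((u h - u k) + (u h - u k)) (u (h * h)%g - u (k * k)%g) 0.
rewrite !subr0; have := ler_normD (u h - u k) (u h - u k).
by have := normr_ge0 (u h - u k); lra.
Qed.

(** The roots of the iterates are controlled one after the other: [psi] maps the
    root at time [i] to some root at time [i + 1], which is small by continuity
    of [psi], hence within [4 s / 7] of 1 by the estimate on squares. *)
Let bowen_sqrt t s h : (0 < t)%N -> s <= 4 * eps -> W t s h ->
  exists2 k, W t (4 / 7 * s) k & (k * k)%g = h.
Proof.
move=> t0 se Wh; have B0 := Wh 0%N t0.
have s0 : 0 < s by case: B0 => _ /(le_lt_trans (normr_ge0 _)).
have s47 : 4 / 7 * s <= 4 * eps by lra.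
have [k Bk kk] := nlc_sqrt lc (ball_mono (le_trans se eps_r) B0).
exists k => //.
have half i k' : (i < t)%N -> B r k' -> (k' * k')%g = iter i psi h -> B (4 / 7 * s) k'.
  move=> it Bk' E; split; first by case: Bk'.
  by have := sqr_lower Bk'; rewrite E; have [_] := Wh _ it; lra.
elim=> [|i IH] it /=; first exact: (half 0%N).
have Bi := eps_psi (ball_mono s47 (IH (ltnW it))).
by apply: half it Bi _; rewrite -[psi _]/(iter i.+1 psi k) -iterM kk.
Qed.

(** Squaring is 3-Lipschitz, so square roots of an [eta]-separated family are
    [eta / 3]-separated. *)
Let packs_halve t s eta N : (0 < t)%N -> s <= 4 * eps -> 0 < eta ->
  packs u eta (W t s) N ->
  exists N', packs u eta (W t (4 / 7 * s)) N' /\ (N <= 4 ^ n * N')%N.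
Proof.
move=> t0 se eta0 [x [Wx sep]].
have [y Wy yy] : exists2 y : 'I_N -> G, forall i, W t (4 / 7 * s) (y i) &
    forall i, (y i * y i)%g = x i.
  have H i : exists k, W t (4 / 7 * s) k /\ (k * k)%g = x i.
    by have [k] := bowen_sqrt t0 se (Wx i); exists k.
  by exists (fun i => sval (cid (H i))) => i; case: cid => k [].
have By i : B r (y i).
  have := Wy i 0%N t0; apply: ball_mono; move: eps_r eps0; lra.
have e3 : 0 < eta / 3 by lra.
have P : packs u (eta / 3) (W t (4 / 7 * s)) N.
  exists y; split=> // i j /sep; rewrite -!yy.
  by have := sqr_upper (By i) (By j); lra.
have [N' [PN' NN']] := packs_coarsen 3 e3 P.
by exists N'; split=> //; move: PN'; rewrite mulrC divfK.
Qed.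

Let packs_shrink t eta m N : (0 < t)%N -> 0 < eta ->
  packs u eta (W t (4 * eps)) N ->
  exists N', packs u eta (W t ((4 / 7) ^+ m * (4 * eps))) N' /\
    (N <= (4 ^ n) ^ m * N')%N.
Proof.
move=> t0 eta0 PN; elim: m => [|m [N' [PN' NN']]].
  by exists N; rewrite expr0 mul1r expn0 mul1n.
have e4 : 0 <= 4 * eps by rewrite mulr_ge0// ltW.
have [|N2 [PN2 NN2]] := packs_halve t0 _ eta0 PN'.
  by rewrite ler_piMl// exprn_ile1//; lra.
exists N2; split; first by rewrite exprS -mulrA.
by rewrite expnSr -mulnA (leq_trans NN')// leq_mul2l NN2 orbT.
Qed.

Let iter_near t d : 0 < d -> exists2 e, 0 < e & B e `<=` W t d.
Proof.
move=> d0; suff : nbhs (1%g : G) (W t d) by exact: nlc_base lc _.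
elim: t => [|t IH]; first by apply: filterS (@filterT _ (nbhs (1%g : G)) _) => h _ [].
have citer : iter t psi @ (1%g : G) --> (1%g : G).
  elim: t {IH} => [|t IH]; first exact: cvg_id.
  have := cpsi; rewrite /prop_for /continuous_at psi1 => cp.
  exact: (cvg_comp _ psi IH cp).
have := citer _ (nlc_nbhs lc d0); rewrite nbhs_simpl => Ht.
apply: filterS2 IH Ht => h Wh Bh i; rewrite ltnS leq_eqVlt => /predU1P[->//|].
exact: Wh.
Qed.

(** The order on the indices matters: the condition is not symmetric in [i] and
    [j], and a family is extended by adding a last element. *)
Definition bowen_separated (t : nat) (d : R) (M : nat) (k : nat -> G) :=
  (forall i, (i < M)%N -> W t eps (k i)) /\
  (forall i j, (j < i)%N -> (i < M)%N -> ~ W t d (k i * (k j)^-1)%g).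

(** The volume argument. Let [h] run over a maximal [eta]-separated family of the
    set of radius [d1], where [d1] is a fraction of [d]. For [k] in a separated
    family, the products [h * k] are [eta / 2]-separated: if [h * k] and [h' * k']
    were closer, [k * k'^-1] would be a product of three elements of the set of
    radius [d1], contradicting the separation of [k] and [k']. These products lie
    in the set of radius [4 eps], where maximal families are, up to a constant
    depending on [d] and [eps] only, not larger than the one indexed by [h]. *)
Lemma bowen_separated_bounded d : 0 < d -> exists C, forall t M k,
  (0 < t)%N -> bowen_separated t d M k -> (M <= C)%N.
Proof.
move=> d0; (* [h^-1 * z * h'] has norm below [6 * d1] when [h], [z], [h'] have norm below [d1]. *)
pose d1 := Num.min eps (d / 8).
have d10 : 0 < d1 by rewrite lt_min eps0/= divr_gt0.
have d1e : d1 <= eps by rewrite ge_min lexx.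
have d1d : d1 <= d / 8 by rewrite ge_min lexx orbT.
(* [m] square roots bring the radius from [4 eps] down to [d1]. *)
have [m Hm] : exists m, (4 / 7) ^+ m * (4 * eps) <= d1.
  have e4 : 0 < 4 * eps by rewrite mulr_gt0.
  have /cvgr0Pnorm_le /(_ (d1 / (4 * eps)) (divr_gt0 d10 e4)) : (4 / 7 : R) ^+ m @[m --> \oo] --> 0.
    by apply: cvg_expr; rewrite ger0_norm; lra.
  case=> m _ /(_ m (leqnn m)) /= H; exists m.
  by rewrite -ler_pdivlMr// (le_trans _ H)// ler_norm.
exists (3 ^ n * (4 ^ n) ^ m)%N => t M k t0 [Wk sepk].
(* [eta] depends on [t], but only the ratios of the radii enter the final bound. *)
have [eta eta0 Heta] := iter_near t d10.
have bnd : forall h, W t d1 h -> `|u h| <= d1.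
  by move=> h /(_ 0%N t0)[_ /ltW].
have [C HC] := packs_bounded eta0 bnd.
have ex0 : exists N, `[< packs u eta (W t d1) N >].
  exists 1%N; apply/asboolP; exists (fun=> 1%g); split=> [_|i j]; first exact: W1.
  by rewrite !ord1.
have exC N : `[< packs u eta (W t d1) N >] -> (N <= C)%N by move/asboolP; exact: HC.
case: (ex_maxnP ex0 exC) => N0 /asboolP[h [Wh seph]] maxN0.
have N00 : (0 < N0)%N.
  apply: maxN0; apply/asboolP; exists (fun=> 1%g); split=> [_|i j]; first exact: W1.
  by rewrite !ord1.
have Whk a b : (b < M)%N -> W t (4 * eps) (h a * k b)%g.
  move=> bM i it; rewrite iterM.
  have Bh := ball_mono d1e (Wh a i it); have Bk := Wk b bM i it.
  apply: ball_mono (norm_mul _ _ Bh Bk); move: eps_r eps0; lra.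
have far a a' b b' : (b' < b)%N -> (b < M)%N ->
    eta / 2 <= `|u (h a * k b)%g - u (h a' * k b')%g|.
  move=> b'b bM; have b'M := ltn_trans b'b bM; rewrite leNgt; apply/negP => close.
  apply: (sepk b b' b'b bM).
  set x := (h a * k b)%g in close; set y := (h a' * k b')%g in close.
  have Bx : B r x := ball_mono eps_r (Whk a b bM 0%N t0).
  have By4 : B (4 * eps) y := Whk a' b' b'M 0%N t0.
  have By := ball_mono eps_r By4; have Byi := eps_inv By4.
  have Bxy : B eta (x * y^-1)%g.
    split; first exact: nlc_mul_dom lc _ _ Bx Byi.
    have := nlc_mul lc Bx By Byi Byi; rewrite mulgV (nlc_one lc) !subrr normr0 subr0 !addr0.
    have := ler_distD (u x - u y) (u (x * y^-1)%g) 0; rewrite !subr0.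
    by lra.
  have Wxy := Heta _ Bxy.
  have -> : (k b * (k b')^-1 = (h a)^-1 * (x * y^-1) * h a')%g.
    by rewrite /x /y invgM !mulgA mulVg mul1g mulgVK.
  move=> i it; rewrite 2!iterM iterV.
  have d14 : d1 <= 4 * eps by lra.
  have H1 := norm_inv d14 (Wh a i it).
  have H2 : B (4 * d1) ((iter i psi (h a))^-1 * iter i psi (x * y^-1))%g.
    apply: ball_mono (norm_mul _ _ H1 (Wxy i it)); move: eps_r; lra.
  apply: ball_mono (norm_mul _ _ H2 (Wh a' i it)); move: eps_r; lra.
have P : packs u (eta / 2) (W t (4 * eps)) (N0 * M).
  have -> : (N0 * M = #|[set: 'I_N0 * 'I_M]%SET|)%N by rewrite cardsT card_prod !card_ord.
  apply: (@packs_finset R n G u (eta / 2) _ ('I_N0 * 'I_M)%type _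
    (fun ab => (h ab.1 * k ab.2)%g)) => [[a b] _|]; first exact: Whk.
  move=> [a b] [a' b'] _ _ /=; rewrite xpair_eqE negb_and.
  have [E|] := eqVneq b b'; last first.
    rewrite neq_ltn => /orP[bb' _|bb' _]; last exact: far.
    by rewrite distrC; exact: far.
  rewrite orbF => /seph; rewrite -E.
  have Bh c : B r (h c) by apply: ball_mono (Wh c 0%N t0); move: eps_r; lra.
  have Bk : B r (k b) by apply: ball_mono (Wk b (ltn_ord b) 0%N t0); move: eps_r; lra.
  have := nlc_mul lc (Bh a) (Bh a') Bk Bk; rewrite subrr normr0 !addr0.
  have := ler_distD (u (h a * k b)%g - u (h a' * k b)%g) (u (h a) - u (h a')) 0.
  by rewrite !subr0 distrC; lra.
have e2 : 0 < eta / 2 by lra.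
have [N1 [P1 NN1]] := packs_coarsen 2 e2 P.
rewrite mulrC divfK// in P1.
have [N2 [P2 NN2]] := packs_shrink m t0 eta0 P1.
have N20 : (N2 <= N0)%N.
  apply: maxN0; apply/asboolP; have [x [Wx sx]] := P2.
  by exists x; split=> // i; apply: W_mono (Wx i).
rewrite -(leq_pmul2l N00) (leq_trans NN1)// mulnCA leq_mul2l.
by rewrite (leq_trans NN2) ?orbT// mulnC leq_mul2r N20 orbT.
Qed.

(** If a maximal separated family did not cover, an uncovered element could be added
    at its end. *)
Lemma bowen_nbhd_cover d : 0 < d -> exists C, forall t, (0 < t)%N ->
  exists M (k : nat -> G), [/\ (M <= C)%N, (forall i, (i < M)%N -> W t eps (k i)) &
    forall h, W t eps h -> exists2 i, (i < M)%N & W t d (h * (k i)^-1)%g].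
Proof.
move=> d0; have [C HC] := bowen_separated_bounded d0; exists C => t t0.
pose P M := `[< exists k, bowen_separated t d M k >].
have P0 : exists M, P M.
  by exists 0%N; apply/asboolP; exists (fun=> 1%g); split=> [i|i j _].
have PC M : P M -> (M <= C)%N by move=> /asboolP[k]; exact: HC.
case: (ex_maxnP P0 PC) => M /asboolP[k [Wk sepk]] maxM.
exists M, k; split=> [||h Wh]//; first by apply: PC; apply/asboolP; exists k.
apply: contrapT => nocov.
have : (M.+1 <= M)%N; last by rewrite ltnn.
apply: maxM; apply/asboolP; exists (fun i => if i == M then h else k i).
split=> [i|i j ji]; rewrite ltnS leq_eqVlt.
  by have [//|_ /=] := eqVneq i M; exact: Wk.
have [iM _|_ /= iM] := eqVneq i M.
  rewrite ifF; last by rewrite -iM ltn_eqF.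
  by move=> Whk; apply: nocov; exists j; rewrite -?iM.
by rewrite ifF; [exact: sepk|rewrite ltn_eqF// (ltn_trans ji)].
Qed.

End local_dynamics.

(** * Two-variable maps and derivatives along curves *)

Section products.
Context {R : realType} {n : nat}.
Local Notation V := 'rV[R]_n.

Lemma mulmx_norm_le p q (v : 'rV[R]_p) (P : 'M[R]_(p, q)) :
  `|v *m P| <= p%:R * `|P| * `|v|.
Proof.
apply: rV_norm_le => [|j]; first by rewrite !mulr_ge0.
rewrite mxE (le_trans (ler_norm_sum _ _ _))//.
have -> : p%:R * `|P| * `|v| = \sum_(k < p) `|P| * `|v|.
  by rewrite sumr_const card_ord -mulrA mulr_natl.
apply: ler_sum => k _; rewrite normrM mulrC ler_pM ?coord_norm_le//.
rewrite [leRHS]/Num.Def.normr/= mx_normrE.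
exact: (le_bigmax _ (fun i : 'I_p * 'I_q => `|P i.1 i.2|) (k, j)).
Qed.

Definition pair_basis (k : 'I_n + 'I_n) : V * V :=
  match k with inl i => (delta_mx 0 i, 0) | inr i => (0, delta_mx 0 i) end.

Definition pair_coord (k : 'I_n + 'I_n) (v : V * V) : R :=
  match k with inl i => v.1 0 i | inr i => v.2 0 i end.

Lemma pair_basis_norm k : `|pair_basis k| <= 1.
Proof.
have H i : `|delta_mx 0 i : V| <= 1.
  apply: rV_norm_le => // j; rewrite mxE eqxx/=.
  by case: (_ == _); rewrite ?normr1 ?normr0.
by case: k => i; rewrite prod_normE/= normr0 ge_max ler01 H.
Qed.

Lemma pair_coord_norm k v : `|pair_coord k v| <= `|v|.
Proof.
by case: k => i; rewrite prod_normE/= le_max coord_norm_le ?orbT.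
Qed.

Lemma pair_coordK v : v = \sum_k pair_coord k v *: pair_basis k.
Proof.
rewrite big_sumType/= [in LHS](surjective_pairing v).
have -> : \sum_i v.1 0 i *: (delta_mx 0 i, 0 : V) = (v.1, 0) :> V * V.
  rewrite [v.1 in RHS]row_sum_delta; apply: (big_ind2 (fun (a : V * V) b => a = (b, 0))) => //.
  - by move=> a b c d -> ->; congr pair; rewrite /= addr0.
  - by move=> i _; congr pair; rewrite /= scaler0.
have -> : \sum_i v.2 0 i *: (0 : V, delta_mx 0 i) = (0, v.2) :> V * V.
  rewrite [v.2 in RHS]row_sum_delta; apply: (big_ind2 (fun (a : V * V) b => a = (0, b))) => //.
  - by move=> a b c d -> ->; congr pair; rewrite /= addr0.
  - by move=> i _; congr pair; rewrite /= scaler0.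
by congr pair; rewrite /= ?addr0 ?add0r.
Qed.

Lemma pair_coord_mulmx q (d : 'I_n + 'I_n -> 'rV[R]_q) (v w : V * V) :
  (v.1 - w.1) *m (\matrix_k d (inl k)) + (v.2 - w.2) *m (\matrix_k d (inr k)) =
  \sum_k pair_coord k (v - w) *: d k.
Proof.
rewrite !mulmx_sum_row big_sumType; congr (_ + _);
by apply: eq_bigr => k _; rewrite rowK.
Qed.

(** Both partial derivatives are recorded as matrices acting on row vectors. *)
Lemma strict_derivative_pair q (f : V * V -> 'rV[R]_q) (U : set (V * V)) (x : V * V) :
  smooth_on U f -> nbhs x U ->
  exists P Q : 'M[R]_(n, q), forall eta : R, 0 < eta ->
    exists2 rho : R, 0 < rho & forall y z : V * V, `|y - x| < rho -> `|z - x| < rho ->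
    `|f z - f y - ((z.1 - y.1) *m P + (z.2 - y.2) *m Q)| <= eta * `|z - y|.
Proof.
move=> sf Ux.
pose d k := 'D_(pair_basis k) f x.
exists (\matrix_k d (inl k)), (\matrix_k d (inr k)).
move=> eta eta0.
have [||rho rho0 H] := strict_derivative pair_basis_norm pair_coord_norm pair_coordK
   (f := f) (x := x) _ _ eta0.
- by apply: filterS Ux => z Uz k; have [_] := sf z Uz [::]; exact.
- by move=> k; have [] := sf x (nbhs_singleton Ux) [:: pair_basis k].
exists rho => // y z yx zx; apply: le_trans (H y z yx zx).
by rewrite pair_coord_mulmx.
Qed.

(** The chain rule along a curve, for a map known through its linear
    approximation at one point. *)
Lemma is_derive_strict p q (f : 'rV[R]_p -> 'rV[R]_q) (P : 'M[R]_(p, q)) (c : R -> 'rV[R]_p) t w :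
  (forall eta : R, 0 < eta ->
     \forall y \near c t, `|f y - f (c t) - (y - c t) *m P| <= eta * `|y - c t|) ->
  is_derive t (1 : R) c w -> is_derive t (1 : R) (f \o c) (w *m P).
Proof.
move=> fP [dc cw].
have ct : {for t, continuous c}.
  by apply: differentiable_continuous; exact/derivable1_diffP.
have qw : h^-1 *: (c (h *: 1 + t) - c t) @[h --> 0^'] --> w by rewrite -cw; exact: dc.
suff H : h^-1 *: (f (c (h *: 1 + t)) - f (c t)) @[h --> 0^'] --> w *m P.
  by split; [apply/cvg_ex; exists (w *m P)|exact: cvg_lim].
apply/cvgrPdist_le => e e0.
pose K := p%:R * `|P| + `|w| + 2.
have K0 : 0 < K by rewrite ltr_wpDl// addr_ge0// mulr_ge0.
pose eta := Num.min 1 (e / K).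
have eta0 : 0 < eta by rewrite lt_min ltr01 divr_gt0.
have eta1 : eta <= 1 by rewrite ge_min lexx.
have etaK : eta * K <= e by rewrite -ler_pdivlMr// ge_min lexx orbT.
have cvg_ct : c (h *: (1 : R) + t) @[h --> 0^'] --> c t.
  apply: (cvg_comp _ c _ ct).
  apply: cvg_trans (_ : h *: (1 : R) + t @[h --> 0] --> t).
    exact: cvg_app (@nbhs_dnbhs _ _).
  rewrite -[X in _ --> X]add0r; apply: cvgD; last exact: cvg_cst.
  by rewrite -[X in _ --> X](scale0r 1); apply: cvgZl; exact: cvg_id.
have H1 : \forall h \near (0 : R)^', let y := c (h *: (1 : R) + t) in
    `|f y - f (c t) - (y - c t) *m P| <= eta * `|y - c t| := cvg_ct _ (fP eta eta0).
have H2 := (cvgrPdist_le _ _).1 qw eta eta0.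
near=> h.
have h0 : h != 0 by near: h; exact: nbhs_dnbhs_neq.
have Hy : let y := c (h *: (1 : R) + t) in
  `|f y - f (c t) - (y - c t) *m P| <= eta * `|y - c t| by near: h; exact: H1.
have Hq : `|w - h^-1 *: (c (h *: (1 : R) + t) - c t)| <= eta by near: h; exact: H2.
set y := c _ in Hy Hq *.
set v := h^-1 *: (y - c t) in Hq.
have Hv : `|h^-1 *: (f y - f (c t)) - v *m P| <= eta * `|v|.
  rewrite /v -scalemxAl -scalerBr !normrZ mulrCA.
  by rewrite ler_wpM2l.
have vw : `|v| <= `|w| + eta.
  rewrite -[v](subrK w) addrC (le_trans (ler_normD _ _))// lerD2l.
  by rewrite distrC.
have wP : `|w *m P - v *m P| <= p%:R * `|P| * eta.
  rewrite -mulmxBl (le_trans (mulmx_norm_le _ _))// ler_wpM2l// mulr_ge0//.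
rewrite (le_trans (ler_distD (v *m P) _ _))//.
apply: le_trans etaK; rewrite /K.
rewrite distrC in Hv.
have : eta * `|v| <= eta * (`|w| + 1) by rewrite ler_wpM2l ?(ltW eta0)// (le_trans vw) ?lerD2l.
by lra.
Unshelve. all: by end_near. Qed.

Lemma is_derive_affine p (x w : 'rV[R]_p) (t : R) :
  is_derive t (1 : R) (fun s : R => x + s *: w) w.
Proof.
suff H : h^-1 *: (x + (h *: (1 : R) + t) *: w - (x + t *: w)) @[h --> (0 : R)^'] --> w.
  by split; [apply/cvg_ex; exists w|exact: cvg_lim].
apply: (@cvg_trans _ ((fun=> w) @ (0 : R)^')); last exact: cvg_cst.
apply: near_eq_cvg; near=> h.
have h0 : h != 0 by near: h; exact: nbhs_dnbhs_neq.
by rewrite opprD addrACA subrr add0r -scalerBl addrK [h *: 1]mulr1 scalerA mulVf ?scale1r.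
Unshelve. all: by end_near. Qed.

Lemma derive_strict p q (f : 'rV[R]_p -> 'rV[R]_q) (P : 'M[R]_(p, q)) x w :
  (forall eta : R, 0 < eta ->
     \forall y \near x, `|f y - f x - (y - x) *m P| <= eta * `|y - x|) ->
  'D_w f x = w *m P.
Proof.
move=> fP.
have dl := is_derive_affine x w 0.
have [|_ <-] := @is_derive_strict _ _ f P (fun s : R => x + s *: w) 0 w _ dl.
  by rewrite scale0r addr0.
rewrite /derive; set A := (X in lim (X @ _) = _); set B := (X in _ = lim (X @ _)).
suff -> : A = B by [].
apply/funext => h; rewrite /A /B /=.
by rewrite scale0r !addr0 [h *: 1]mulr1 [x + _]addrC.
Qed.

End products.

(** * Coordinates in which multiplication is almost addition *)

HB.instance Definition _ (R : realType) (n : nat) := Complete.on 'rV[R]_n.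

Section lie_group_coordinates.
Context {R : realType} {n : nat} {G : groupTopologicalType}.
Variable A : atlas 'rV[R]_n G.
Local Notation V := 'rV[R]_n.

Lemma nbhs_chart_image (M : topologicalType) (B : atlas V M) (i : B) x (O : set M) :
  smooth_manifold B -> dom B i x -> nbhs x O ->
  nbhs (coord B i x) (coord B i @` (dom B i `&` O)).
Proof.
move=> mB ix xO; have ci : chart_image B i (coord B i x) by exists x.
have := param_continuous mB ci; rewrite /prop_for /continuous_at (coordK mB ix) => cp.
have H1 : \forall v \near coord B i x, O (param B i v) := cp _ xO.
have H2 := open_nbhs_nbhs (conj (chart_image_open mB i) ci).
apply: filterS2 H1 H2 => v /= Ov [y iy yv]; exists y => //; split=> //.
by move: Ov; rewrite -yv (coordK mB iy).
Qed.

Hypothesis lA : lie_group A.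
Let mA : smooth_manifold A. Proof. by case: lA. Qed.

Lemma mulg_continuous : continuous (fun p : G * G => (p.1 * p.2)%g).
Proof. by case: lA => _ []. Qed.

Lemma invg_continuous : continuous (fun x : G => x^-1%g).
Proof. by case: lA => _ _ []. Qed.

Definition mul_in_charts (i j k : A) (p : V * V) : V :=
  coord A k (param A i p.1 * param A j p.2)%g.

Lemma mul_strict_derivative (i j k : A) (x y : G) :
  dom A i x -> dom A j y -> dom A k (x * y)%g ->
  exists P Q : 'M[R]_n, forall eta : R, 0 < eta ->
    exists2 rho : R, 0 < rho & forall p q : V * V,
      `|p - (coord A i x, coord A j y)| < rho ->
      `|q - (coord A i x, coord A j y)| < rho ->
      `|mul_in_charts i j k q - mul_in_charts i j k p -
        ((q.1 - p.1) *m P + (q.2 - p.2) *m Q)| <= eta * `|q - p|.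
Proof.
move=> ix jy kxy; have [_ [_ sm] _] := lA.
apply: strict_derivative_pair (sm (i, j) k) _.
have Oxy : nbhs (x * y)%g (dom A k) by apply: open_nbhs_nbhs; split=> //; exact: dom_open mA k.
have [[U1 U2] [/= xO1 yO2] US] := @mulg_continuous (x, y) _ Oxy.
exists (coord A i @` (dom A i `&` U1), coord A j @` (dom A j `&` U2)).
  by split; exact: nbhs_chart_image.
move=> [v w] [/= [x' [ix' Ox'] <-] [y' [jy' Oy'] <-]].
exists (x', y') => //; split=> //; exact: (US (x', y')).
Qed.

Section at_identity.
Variable i : A.
Hypothesis i1 : dom A i 1%g.
Local Notation e := (coord A i 1%g).
Local Notation m := (mul_in_charts i i i).

Let ball_chart (O : set G) : nbhs 1%g O -> exists2 rho : R, 0 < rho &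
  forall v, `|v - e| < rho -> chart_image A i v /\ O (param A i v).
Proof.
move=> /(nbhs_chart_image mA i1)/nbhs_normP[rho rho0 H]; exists rho => // v ve.
have [|x [ix Ox] <-] := H v; first by rewrite /= /ball_/= distrC.
by split; [exists x|rewrite (coordK mA ix)].
Qed.

(** Strict differentiability at [(1, 1)]. The two partial derivatives are the
    identity since [h * 1 = 1 * h = h]. *)
Lemma mul_near_linear eta : 0 < eta -> exists2 rho : R, 0 < rho &
  forall p q : V * V, `|p - (e, e)| < rho -> `|q - (e, e)| < rho ->
  `|m q - m p - ((q.1 - p.1) + (q.2 - p.2))| <= eta * (`|q.1 - p.1| + `|q.2 - p.2|).
Proof.
move=> eta0.
have i11 : dom A i (1 * 1)%g by rewrite mulg1.
have [P [Q H]] := mul_strict_derivative i1 i1 i11.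
have eta2 : 0 < eta / 2 by rewrite divr_gt0.
have [rho rho0 Hrho] := H _ eta2.
have [rho1 rho10 H1] := ball_chart (@filterT _ (nbhs 1%g) _).
pose r := Num.min rho rho1.
have r_rho : r <= rho by rewrite ge_min lexx.
have r_rho1 : r <= rho1 by rewrite ge_min lexx orbT.
have ml v : `|v - e| < r -> m (v, e) = v /\ m (e, v) = v.
  move=> ve; have [[x ix xv] _] := H1 v (lt_le_trans ve r_rho1).
  by rewrite /mul_in_charts/= -xv !(coordK mA) ?i1// mulg1 mul1g.
have e_r : `|e - e| < r by rewrite subrr normr0 lt_min rho0.
have HP v w : `|v - e| < r -> `|w - e| < r -> `|v - w - (v - w) *m P| <= eta / 2 * `|v - w|.
  move=> vr wr; have := Hrho (w, e) (v, e).
  rewrite (ml v vr).1 (ml w wr).1 /= !prod_normE/= !subrr normr0 mul0mx addr0.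
  by rewrite !max_l//; apply; exact: lt_le_trans r_rho.
have HQ v w : `|v - e| < r -> `|w - e| < r -> `|v - w - (v - w) *m Q| <= eta / 2 * `|v - w|.
  move=> vr wr; have := Hrho (e, w) (e, v).
  rewrite (ml v vr).2 (ml w wr).2 /= !prod_normE/= !subrr normr0 mul0mx add0r.
  by rewrite !max_r//; apply; exact: lt_le_trans r_rho.
exists r; first by rewrite lt_min rho0.
move=> p q pr qr.
have := Hrho p q (lt_le_trans pr r_rho) (lt_le_trans qr r_rho).
move: pr qr; rewrite !prod_normE/= !gt_max => /andP[p1 p2] /andP[q1 q2].
have := HP _ _ q1 p1; have := HQ _ _ q2 p2.
set a := q.1 - p.1; set b := q.2 - p.2; set c := m q - m p => Hb Ha Hc.
have -> : c - (a + b) = c - (a *m P + b *m Q) - ((a - a *m P) + (b - b *m Q)).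
  by rewrite (addrACA a) -(opprD (a *m P)) (opprB (a + b)) (addrA (c - _)) subrK.
rewrite (le_trans (ler_normB _ _))//.
have := ler_normD (a - a *m P) (b - b *m Q).
have ab : Num.max `|a| `|b| <= `|a| + `|b| by rewrite ge_max lerDl lerDr !normr_ge0.
have := ler_wpM2l (ltW eta2) ab.
by move: Hc; lra.
Qed.

(** Square roots are found as fixed points of [v |-> v - (v * v - y) / 2], which
    is a contraction of the closed ball of radius [|y - e|] about [e], as
    squaring is close to doubling. *)
Lemma lie_group_near_linear_coords :
  exists r, near_linear_coords (dom A i) (fun h => coord A i h - e) r.
Proof.
have [rho rho0 Hm] := @mul_near_linear 8^-1 ltac:(by rewrite invr_gt0).
have imul : nbhs (1%g : G) (dom A i).
  by apply: open_nbhs_nbhs; split=> //; exact: dom_open mA i.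
have [[U1 U2] [/= H1 H2] US] : nbhs ((1%g, 1%g) : G * G) (fun p => dom A i (p.1 * p.2)%g).
  by apply: mulg_continuous; rewrite /= mulg1.
have [rho1 rho10 Hball] := ball_chart (filterI H1 H2).
pose r := Num.min rho rho1.
have r0 : 0 < r by rewrite lt_min rho0.
have r_rho : r <= rho by rewrite ge_min lexx.
have r_rho1 : r <= rho1 by rewrite ge_min lexx orbT.
pose u h := coord A i h - e.
have usub a b : u a - u b = coord A i a - coord A i b.
  by rewrite /u opprB addrA subrK.
have mulD h k : coord_ball (dom A i) u r h -> coord_ball (dom A i) u r k ->
    dom A i (h * k)%g.
  move=> [ih hr] [ik kr]; apply: (US (h, k)); split => /=.
  - have [_ []] := Hball _ (lt_le_trans hr r_rho1); by rewrite (coordK mA ih).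
  - have [_ []] := Hball _ (lt_le_trans kr r_rho1); by rewrite (coordK mA ik).
exists r; rewrite -/u; split=> //.
- by rewrite /u subrr.
- move=> d d0; have /cvgrPdist_lt /(_ d d0) H := coord_continuous mA i1.
  by apply: filterS2 imul H => h ih; rewrite distrC.
- move=> U /ball_chart[d d0 H]; exists d => // h [ih /H[_]].
  by rewrite (coordK mA ih).
- move=> h h' k k' [ih hr] [ih' hr'] [ik kr] [ik' kr'].
  have := Hm (coord A i h', coord A i k') (coord A i h, coord A i k).
  rewrite /mul_in_charts/= !(coordK mA)// !prod_normE/= !gt_max.
  rewrite !(lt_le_trans _ r_rho)// => /(_ isT isT) H.
  by rewrite !usub; exact: H.
- move=> h [ih hr]; set y := coord A i h in hr *.
  set s := `|y - e| in hr.
  have mI v w : `|v - e| < r -> `|w - e| < r ->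
      `|m (v, v) - m (w, w) - ((v - w) + (v - w))| <= 4^-1 * `|v - w|.
    move=> vr wr; have := Hm (w, w) (v, v); rewrite !prod_normE/= !gt_max.
    rewrite !(lt_le_trans _ r_rho)// => /(_ isT isT) H; apply: le_trans H _.
    by have := normr_ge0 (v - w); lra.
  pose F v := v - 2^-1 *: (m (v, v) - y).
  have FI v w : `|v - e| < r -> `|w - e| < r -> `|F v - F w| <= 8^-1 * `|v - w|.
    move=> vr wr; have := mI v w vr wr.
    have -> : F v - F w = - (2^-1 *: (m (v, v) - m (w, w) - ((v - w) + (v - w)))).
      have half : 2^-1 *: ((v - w) + (v - w)) = v - w.
        by rewrite -[X in _ *: X]mulr2n -(scaler_nat 2 (v - w)) scalerA mulVf// scale1r.
      rewrite /F (opprB w) (addrC _ (- w)) (addrACA v).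
      rewrite [_ *: _ in RHS]scalerBr half [RHS]opprB; congr (_ + _).
      rewrite addrC -scalerBr -scalerN; congr (_ *: _).
      by rewrite !opprB addrA subrK.
    by rewrite normrN normrZ gtr0_norm ?invr_gt0//; lra.
  have mee : m (e, e) = e by rewrite /mul_in_charts/= (coordK mA i1) mulg1.
  have [x [xs Fx]] : exists x, `|x - e| <= s /\ F x = x.
    pose C : set V := closed_ball_ Num.norm e s.
    have CE x : C x = (`|x - e| <= s) :> Prop by rewrite /C/closed_ball_/= distrC.
    have Cr x : C x -> `|x - e| < r by rewrite CE => /le_lt_trans; apply.
    have Ce : C e by rewrite CE subrr normr0 normr_ge0.
    have FC : {homo F : x / C x >-> C x}.
      move=> x Cx; rewrite CE -[F x](subrK (F e)) -addrA.
      rewrite (le_trans (ler_normD _ _))//.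
      have := FI x e (Cr _ Cx) (Cr _ Ce).
      have -> : `|F e - e| = 2^-1 * s.
        by rewrite /F mee addrAC subrr add0r normrN normrZ gtr0_norm ?invr_gt0// distrC.
      by have : 0 <= s := normr_ge0 _; move: Cx; rewrite CE; lra.
    have ctr : is_contraction (mkfun_fun FC).
      exists (NngNum (ltac:(by rewrite invr_ge0) : 0 <= 8^-1 :> R)); split=> /=.
        by rewrite invf_lt1// ltr1n.
      by move=> [v w] [/= Cv Cw]; exact: FI (Cr _ Cv) (Cr _ Cw).
    have [||x Cx xF] := banach_fixed_point ctr.
    - exact: closed_closed_ball_.
    - by exists e.
    by exists x; rewrite -CE.
  have mxy : m (x, x) = y.
    apply/eqP; rewrite -subr_eq0; move: Fx => /eqP.
    by rewrite /F -subr_eq0 addrAC subrr add0r oppr_eq0 scaler_eq0 invr_eq0 pnatr_eq0.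
  have xr : `|x - e| < r := le_lt_trans xs hr.
  have [[k ik kx] _] := Hball _ (lt_le_trans xr r_rho1).
  have pk : param A i x = k by rewrite -kx (coordK mA).
  have Bk : coord_ball (dom A i) u r k by split; rewrite // /u kx.
  exists k => //; have ikk := mulD _ _ Bk Bk.
  rewrite -(coordK mA ih) -/y -mxy /mul_in_charts/= pk.
  by rewrite (coordK mA ikk).
Qed.


End at_identity.
End lie_group_coordinates.

(** * The topology of the coset space *)

Section coset_topology.
Local Open Scope group_scope.
Context {G : groupTopologicalType} (L : groupClosed G).
Hypothesis mulC : continuous (fun p : G * G => p.1 * p.2).
Hypothesis invC : continuous (fun x : G => x^-1).

Lemma cvg_mulg (T : Type) (F : set_system T) {FF : Filter F} (f h : T -> G) a b :
  f @ F --> a -> h @ F --> b -> (fun t => f t * h t) @ F --> a * b.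
Proof.
move=> fa hb.
have fh : (fun t => (f t, h t)) @ F --> ((a, b) : G * G) by exact: cvg_pair.
exact: (cvg_comp _ (fun p : G * G => p.1 * p.2) fh (@mulC (a, b))).
Qed.

Lemma cvg_invg (T : Type) (F : set_system T) {FF : Filter F} (f : T -> G) a :
  f @ F --> a -> (fun t => (f t)^-1) @ F --> a^-1.
Proof. by move=> fa; apply: (cvg_comp _ (fun x => x^-1) fa); exact: invC. Qed.

Lemma coset_pi_mulr x a : a \in L -> coset_pi L (x * a) = coset_pi L x.
Proof. by move=> aL; apply/esym/coset_piP; rewrite mulKg. Qed.

Lemma coset_pi_surj q : exists x, coset_pi L x = q.
Proof. by exists (repr q); exact: reprK. Qed.

Lemma coset_pi_nbhs x (U : set G) : nbhs x U -> nbhs (coset_pi L x) (coset_pi L @` U).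
Proof.
rewrite nbhsE => -[Z [oZ Zx] ZU].
apply: (@filterS _ _ _ (coset_pi L @` Z)).
  by move=> _ [z Zz <-]; exists z => //; exact: ZU.
apply: open_nbhs_nbhs; split; last by exists x.
suff : open (coset_pi L @^-1` (coset_pi L @` Z)) by [].
rewrite openE => y [z Zz /coset_piP zy].
have nz : nbhs (y * (z^-1 * y)^-1) Z.
  by rewrite invgM invgK mulVKg; exact: open_nbhs_nbhs.
have cy : (fun y' => y' * (z^-1 * y)^-1) @ y --> y * (z^-1 * y)^-1.
  by apply: cvg_mulg; [exact: cvg_id|exact: cvg_cst].
have H : \forall y' \near y, Z (y' * (z^-1 * y)^-1) := cy _ nz.
apply: filterS H => y' /= Zy'.
by exists (y' * (z^-1 * y)^-1) => //; rewrite coset_pi_mulr// gpredV.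
Qed.

(** A property that holds locally in [p] and is invariant under right translation
    by [L] holds uniformly in [p], since it descends to the compact quotient. *)
Lemma compact_coset_uniform (I : Type) (F : set_system I) {FF : Filter F}
    (P : I -> G -> Prop) :
  compact [set: coset_space L] ->
  (forall i p a, a \in L -> P i p -> P i (p * a)) ->
  (forall p0 : G, \forall p \near p0 & i \near F, P i p) ->
  \forall i \near F, forall p, P i p.
Proof.
move=> /compact_near_coveringP cL Pinv Pnear.
suff : \near F, [set: coset_space L] `<=` (fun q => forall p, coset_pi L p = q -> P F p).
  by apply: filterS => i SP p; exact: SP.
apply: (cL I F (fun i q => forall p, coset_pi L p = q -> P i p) FF) => q _.
have [p0 <-] := coset_pi_surj q; have [[U W] [/= Up0 FW] UW] := Pnear p0.
exists (coset_pi L @` U, W); first by split=> //; exact: coset_pi_nbhs.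
move=> [q' i] [/= [p' Up' <-] Wi] p /esym/coset_piP pp'.
by rewrite -(mulVKg p' p); apply: Pinv => //; exact: (UW (p', i)).
Qed.

Hypothesis discL : discrete_subgroup L.

Lemma discrete_gap : \forall x \near (1 : G), x \in L -> x = 1.
Proof.
have [_ [V V1 VL]] := discL (gpred1 : (1 : G) \in L).
apply: filterS V1 => x Vx xL; have : (V `&` [set` L]) x by [].
by rewrite VL.
Qed.

(** If [h * p] and [k * p] have the same image then [p^-1 h^-1 k p] is in [L],
    and it is near 1, uniformly for [p] in a compact set of representatives. *)
Lemma coset_pi_inj_near : compact [set: coset_space L] ->
  \forall hk \near ((1, 1) : G * G), forall p,
    coset_pi L (hk.1 * p) = coset_pi L (hk.2 * p) -> hk.1 = hk.2.
Proof.
move=> cL.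
suff : \forall hk \near ((1, 1) : G * G), forall p,
    (p^-1 * (hk.1^-1 * hk.2) * p) \in L -> hk.1 = hk.2.
  apply: filterS => hk H p /coset_piP E; apply: (H p).
  by move: E; rewrite invgM !mulgA.
apply: (@compact_coset_uniform _ (nbhs ((1, 1) : G * G)) _ (fun hk p =>
    (p^-1 * (hk.1^-1 * hk.2) * p) \in L -> hk.1 = hk.2)) => // [hk p a aL H|p0].
  move=> Ha; apply: H; rewrite -[X in X \in L](mulVKg a) -[X in a * X](mulgK a).
  rewrite gpredM ?gpredV// gpredM ?gpredV//; move: Ha.
  by rewrite invgM !mulgA.
have : (fun x : G * (G * G) => x.1^-1 * (x.2.1^-1 * x.2.2) * x.1) @ (p0, (1, 1))
    --> p0^-1 * (1^-1 * 1) * p0.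
  apply: cvg_mulg; last exact: cvg_fst.
  apply: cvg_mulg; first by apply: cvg_invg; exact: cvg_fst.
  apply: cvg_mulg.
    by apply: cvg_invg; apply: cvg_comp cvg_snd cvg_fst.
  by apply: cvg_comp cvg_snd cvg_snd.
rewrite mulVg mulg1 mulVg => cp.
have H1 : \forall x \near filter_prod (nbhs p0) (nbhs ((1, 1) : G * G)),
    x.1^-1 * (x.2.1^-1 * x.2.2) * x.1 \in L ->
    x.1^-1 * (x.2.1^-1 * x.2.2) * x.1 = 1 := cp _ discrete_gap.
apply: filterS H1; move=> [p [h k]] /= H /H /(congr1 (fun x => p * x * p^-1)).
by rewrite mulg1 mulgV !mulgA mulgV mul1g mulgK => /(congr1 (fun x => h * x)); rewrite mulVKg mulg1.
Qed.

(** The saturation of a small closed set under [L] is closed, which is stated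
    on complements. If [y1 * a1] and [y * a] lie in a small set and
    [y1], [y] are close, then [a1^-1 * a] is near 1, hence [a = a1]; so near
    [x] the saturation is a single translate of [C]. *)
Lemma closed_saturation (p0 : G) : exists2 U, nbhs p0 U &
  forall C : set G, C `<=` U -> closed C -> forall x : G,
    ~ (exists2 a, a \in L & C (x * a)) ->
    \forall y \near x, ~ (exists2 a, a \in L & C (y * a)).
Proof.
have : (fun x : (G * G) * G => x.1.1^-1 * x.2 * x.1.2) @ ((p0, p0), 1)
    --> p0^-1 * 1 * p0.
  apply: cvg_mulg; last by apply: cvg_comp cvg_fst cvg_snd.
  apply: cvg_mulg; last exact: cvg_snd.
  by apply: cvg_invg; apply: cvg_comp cvg_fst cvg_fst.
rewrite mulg1 mulVg => /(_ _ discrete_gap) [[UU W] /= [[[U1 U2] [/= U1p U2p] U12] W1] UW].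
exists (U1 `&` U2); first exact: filterI.
move=> C CU clC x xC.
have : (fun y : G * G => y.1 * y.2^-1) @ (x, x) --> x * x^-1.
  by apply: cvg_mulg; [exact: cvg_fst|apply: cvg_invg; exact: cvg_snd].
rewrite mulgV => /(_ _ W1) [[N1 N2] /= [N1x N2x] NW].
have [[y1 [N1y1 [a1 a1L Cy1]]]|noC] :=
    pselect (exists y1, N1 y1 /\ exists2 a, a \in L & C (y1 * a)); last first.
  by apply: filterS N1x => y N1y [a aL Cya]; apply: noC; exists y; split=> //; exists a.
have oC : open (~` C) by rewrite openC.
have xa1 : nbhs (x * a1) (~` C).
  by apply: open_nbhs_nbhs; split=> // Cx; apply: xC; exists a1.
have ca1 : (fun y => y * a1) @ x --> x * a1 by apply: cvg_mulg; [exact: cvg_id|exact: cvg_cst].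
have Hx : \forall y \near x, ~ C (y * a1) := ca1 _ xa1.
apply: filterS2 N2x Hx => y N2y nCy [a aL Cya]; apply: nCy.
have UWy : ((y1 * a1)^-1 * (y1 * y^-1) * (y * a)) \in L ->
    (y1 * a1)^-1 * (y1 * y^-1) * (y * a) = 1.
  apply: (UW ((y1 * a1, y * a), y1 * y^-1)); split; last exact: (NW (y1, y)).
  by apply: (U12 (y1 * a1, y * a)); split; [exact: (CU _ Cy1).1|exact: (CU _ Cya).2].
have E : (y1 * a1)^-1 * (y1 * y^-1) * (y * a) = a1^-1 * a.
  by rewrite invgM -!mulgA mulKg mulKg.
move: UWy; rewrite E => /(_ _)/(congr1 (fun z => a1 * z)).
by rewrite mulVKg mulg1 => <- //; rewrite gpredM ?gpredV.
Qed.

End coset_topology.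

(** * Integrals of speeds and Gram matrices *)

Section integral_bounds.
Context {R : realType}.
Local Notation mu := (@lebesgue_measure R).
Implicit Types (k phi : R -> R).

Lemma integrable_segment k : (forall t : R, t \in `[0, 1] -> {for t, continuous k}) ->
  mu.-integrable `[0, 1] (EFin \o k).
Proof.
move=> ck; apply: continuous_compact_integrable; first exact: segment_compact.
by apply: continuous_in_subspaceT => t; rewrite inE => /ck.
Qed.

Lemma Rintegral_segment_le k (c : R) : (forall t : R, t \in `[0, 1] -> {for t, continuous k}) ->
  (forall t : R, t \in `[0, 1] -> k t <= c) ->
  \int[mu]_(t in `[0, 1]) k t <= c.
Proof.
move=> ck kc; apply: (@le_trans _ _ (\int[mu]_(t in `[0, 1]) c)).
  apply: le_Rintegral => //.
  - exact: integrable_segment.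
  - by apply: integrable_segment => t _; exact: cst_continuous.
rewrite Rintegral_cst//= lebesgue_measure_itv/= lte_fin ltr01/=.
by rewrite oppr0 addr0 mulr1.
Qed.

(** [c * (\int_0^t k) - phi t] and [c * (\int_0^t k) + phi t] are nondecreasing. *)
Lemma increment_le_Rintegral k phi (c : R) :
  (forall t : R, t \in `[0, 1] -> {for t, continuous k}) ->
  (forall t : R, t \in `[0, 1] ->
    exists2 d, is_derive t (1 : R) phi d & `|d| <= c * k t) ->
  `|phi 1 - phi 0| <= c * \int[mu]_(t in `[0, 1]) k t.
Proof.
move=> ck dphi; have ik := integrable_segment ck.
pose K x : R := \int[mu]_(t in `[0, x]) k t.
have K0 : K 0 = 0 by rewrite /K set_itv1 Rintegral_set1.
have cK : {within `[0, 1], continuous K}.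
  exact: parameterized_integral_continuous ler01 ik.
have cphi : {within `[0, 1], continuous phi}.
  apply: continuous_in_subspaceT => t; rewrite inE => /dphi[d [dt _] _].
  by apply: differentiable_continuous; exact/derivable1_diffP.
have dK (x : R) : x \in `]0, 1[ -> is_derive x (1 : R) K (k x).
  move=> x01; have x01' : x \in `[0, 1] by exact: subset_itv_oo_cc x01.
  move: x01; rewrite in_itv/= => /andP[x0 x1].
  have [dKx Kx] := continuous_FTC1_closed x1 ik x0 (ck x x01').
  by split; [exact: dKx|rewrite -derive1E; exact: Kx].
have bound (s : R) : `|s| = 1 -> s * (phi 1 - phi 0) <= c * K 1.
  move=> s1; pose F := c \*: K - s \*: phi.
  have dF (x : R) : x \in `]0, 1[ ->
      exists2 d, is_derive x (1 : R) F d & 0 <= d.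
    move=> x01; have [|d dp dle] := dphi x; first exact: subset_itv_oo_cc x01.
    have := dK x x01 => dKx.
    exists (c *: k x - s *: d); first by apply: is_deriveB; exact: is_deriveZ.
    rewrite subr_ge0 (le_trans _ dle)// (le_trans (ler_norm _))// normrM s1 mul1r.
    exact: lexx.
  have : F 0 <= F 1.
    apply: (@ger0_derive1_le_cc _ F 0 1); rewrite ?in_itv/= ?lexx ?ler01//.
    - by move=> x /dF[d []].
    - by move=> x /dF[d [? E] d0]; rewrite derive1E E.
    - move=> x; apply: cvgB; apply: cvgZr; [exact: cK|exact: cphi].
  have FE x : F x = c * K x - s * phi x by [].
  by rewrite !FE K0; lra.
rewrite ler_norml; have := bound 1 (normr1 _); have := bound (-1) (normrN1 _).
by rewrite -/(K 1); lra.
Qed.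

End integral_bounds.

Section gram_bounds.
Context {R : realType} {n : nat}.
Implicit Types (S : 'M[R]_n) (u v : 'rV[R]_n).

Lemma gramE S u v : gram S u v = \sum_j (\sum_k u 0 k * S k j) * v 0 j.
Proof. by rewrite /gram !mxE; apply: eq_bigr => j _; rewrite !mxE. Qed.

Lemma gramZ S a u : gram S (a *: u) (a *: u) = a ^+ 2 * gram S u u.
Proof.
by rewrite /gram linearZ/= -!scalemxAl -scalemxAr !mxE mulrA -expr2.
Qed.

Lemma gram_norm_le S u v : `|gram S u v| <= n%:R * n%:R * `|S| * `|u| * `|v|.
Proof.
apply: (le_trans (coord_norm_le _ _)); apply: (le_trans (mulmx_norm_le _ _)).
have vT : `|v^T| <= `|v|.
  rewrite [leLHS]/Num.Def.normr/= mx_normrE; apply: bigmax_le => // -[i j] _ /=.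
  by rewrite mxE (ord1 j) coord_norm_le.
have -> : n%:R * n%:R * `|S| * `|u| * `|v| = n%:R * (`|v| * (n%:R * `|S| * `|u|)).
  by ring.
by rewrite -mulrA ler_wpM2l// ler_pM// mulmx_norm_le.
Qed.

Lemma cvg_gram (T : Type) (F : set_system T) {FF : Filter F}
    (S : T -> 'M[R]_n) (u v : T -> 'rV[R]_n) S0 u0 v0 :
  S @ F --> S0 -> u @ F --> u0 -> v @ F --> v0 ->
  gram (S t) (u t) (v t) @[t --> F] --> gram S0 u0 v0.
Proof.
move=> cS cu cv; under eq_fun do rewrite gramE; rewrite gramE.
have coordc (p q : nat) (M : T -> 'M[R]_(p, q)) (M0 : 'M[R]_(p, q)) i j :
    M @ F --> M0 -> M t i j @[t --> F] --> M0 i j.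
  by move=> MM; apply: (cvg_comp _ (fun N : 'M[R]_(p, q) => N i j) MM);
    exact: matrix_normedtype.coord_continuous.
apply: cvg_big => // [x y|j _]; first exact: add_continuous.
apply: cvgM; last exact: coordc.
apply: cvg_big => // [x y|k _]; first exact: add_continuous.
by apply: cvgM; exact: coordc.
Qed.

End gram_bounds.

(** * Short paths: upper bounds for the quotient distance *)

Section quotient_distance.
Context {R : realType} {n : nat} {G : groupTopologicalType}.
Variables (A : atlas 'rV[R]_n G) (L : groupClosed G) (g : metric_tensor A).
Hypotheses (lA : lie_group A) (discL : discrete_subgroup L).
Hypothesis cL : compact [set: coset_space L].
Hypotheses (rg : riemannian_metric g) (bg : biinvariant g).

Let mA : smooth_manifold A. Proof. by case: lA. Qed.
Let mulC := mulg_continuous lA.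
Let invC := invg_continuous lA.

Lemma quotient_chart_near (p0 : G) (N : set G) : nbhs p0 N ->
  exists2 j : quotient_chart A L, qdom j p0 & qdom j `<=` N.
Proof.
move=> Np0; have [i ip0] := chart_cover mA p0.
have [[N1 N2] [/= N11 N21] N12] := coset_pi_inj_near mulC invC discL cL.
have near1 (M : set G) : nbhs 1%g M -> \forall x \near p0, M (x * p0^-1)%g.
  have : (fun x => x * p0^-1)%g @ p0 --> (p0 * p0^-1)%g.
    by apply: cvg_mulg => //; exact: cvg_cst.
  by rewrite mulgV => c M1; exact: (c _ M1).
have dp0 : nbhs p0 (dom A i) by apply: open_nbhs_nbhs; split=> //; exact: dom_open.
pose U := interior (N `&` dom A i `&` [set x | N1 (x * p0^-1)%g /\ N2 (x * p0^-1)%g]).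
have sub : U `<=` N `&` dom A i `&` [set x | N1 (x * p0^-1)%g /\ N2 (x * p0^-1)%g].
  exact: interior_subset.
have inj x y : U x -> U y -> coset_pi L x = coset_pi L y -> x = y.
  move=> /sub[_ [N1x _]] /sub[_ [_ N2y]] xy.
  apply: (mulIg p0^-1%g); apply: (N12 (x * p0^-1, y * p0^-1)%g _ p0); first by split.
  by rewrite /= !mulgVK.
have Ui : U `<=` dom A i by move=> x /sub[[]].
exists (QuotientChart (@open_interior _ _) Ui inj) => [/=|x /sub[[]]//].
by apply: filterI; [exact: filterI|apply: filterI; exact: near1].
Qed.

Lemma qsectionK (j : quotient_chart A L) x : qdom j x -> qsection j (coset_pi L x) = x.
Proof.
move=> jx; rewrite /qsection; case: xgetP => [y _ [jy yx]|/(_ x)[]//].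
exact: (qdom_inj jy jx yx).
Qed.

Lemma quotient_chart_imageP (j : quotient_chart A L) v :
  chart_image (quotient_atlas A L) j v <-> exists2 x, qdom j x & coord A (qchart j) x = v.
Proof.
split=> [[_ [x jx <-] <-]|[x jx <-]]; first by exists x; rewrite //= qsectionK.
by exists (coset_pi L x); [exists x|rewrite /= qsectionK].
Qed.

Lemma quotient_chart_image_near (j : quotient_chart A L) x : qdom j x ->
  nbhs (coord A (qchart j) x) (chart_image (quotient_atlas A L) j).
Proof.
move=> jx; have := nbhs_chart_image mA (qdom_sub jx)
  (open_nbhs_nbhs (conj (@qdom_open _ _ _ _ _ j) jx)).
by apply: filterS => v [y [_ jy] yv]; apply/quotient_chart_imageP; exists y.
Qed.

Lemma metric_continuous (i : A) v : chart_image A i v -> {for v, continuous (g i)}.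
Proof. by move=> iv; have [] := metric_smooth rg iv [::]. Qed.

Lemma speed_continuous (i : A) (c : R -> 'rV[R]_n) t :
  (forall t, derivable c t 1) -> continuous (derive1 c) -> chart_image A i (c t) ->
  {for t, continuous (fun t => Num.sqrt (gram (g i (c t)) (derive1 c t) (derive1 c t)))}.
Proof.
move=> dc cc' ict.
have cc : c s @[s --> t] --> c t.
  by apply: differentiable_continuous; exact/derivable1_diffP.
apply: (cvg_comp _ Num.sqrt); last exact: sqrt_continuous.
apply: cvg_gram; [|exact: cc'|exact: cc'].
exact: (cvg_comp _ (g i) cc (metric_continuous ict)).
Qed.

(** The segment from [v] to [w] in a chart of the quotient is an admissible arc. *)
Lemma quotient_arc_dist (j : quotient_chart A L) (v w : 'rV[R]_n) (K : R) :
  (forall t : R, t \in `[0, 1] ->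
     chart_image (quotient_atlas A L) j (v + t *: (w - v)) /\
     gram (g (qchart j) (v + t *: (w - v))) (w - v) (w - v) <= K ^+ 2) ->
  0 <= K ->
  (riemannian_dist (quotient_metric L g) (param (quotient_atlas A L) j v)
     (param (quotient_atlas A L) j w) <= K%:E)%E.
Proof.
move=> H K0; pose c (t : R) := v + t *: (w - v).
have dc t : is_derive t (1 : R) c (w - v) by exact: is_derive_affine.
have c'E t : derive1 c t = w - v by rewrite derive1E; case: (dc t).
have dc1 t : derivable c t 1 by case: (dc t).
have cc' : continuous (derive1 c).
  by move=> t; rewrite (_ : derive1 c = cst (w - v)); [exact: cst_continuous|exact/funext].
have imc t : t \in `[0, 1] -> chart_image (quotient_atlas A L) j (c t) by move=> /H[].
have /= := @ChartArc _ _ _ (quotient_atlas A L) (quotient_metric L g) j c dc1 cc' imc.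
set l := Rintegral _ _ _ => arc.
have c0 : c 0 = v by rewrite /c scale0r addr0.
have c1 : c 1 = w by rewrite /c scale1r addrC subrK.
rewrite c0 c1 in arc.
have lK : l <= K.
  apply: Rintegral_segment_le => t t01; last first.
    rewrite /quotient_metric c'E -(ger0_norm K0) -sqrtr_sqr.
    by apply: ler_wsqrtr; have [] := H t t01.
  apply: speed_continuous => //.
  have /quotient_chart_imageP[x jx xc] := imc t t01.
  by exists x => //; exact: qdom_sub jx.
apply: le_trans (_ : l%:E <= _)%E; last by rewrite lee_fin.
apply: ereal_inf_lbound; exists l => //=.
by rewrite -[l]addr0; apply: PathCons arc _; exact: PathNil.
Qed.

Lemma quotient_dist_near (p0 : G) (d : R) : 0 < d -> \forall p \near p0 & q \near p0,
  (riemannian_dist (quotient_metric L g) (coset_pi L p) (coset_pi L q) < d%:E)%E.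
Proof.
move=> d0; have [j jp0 _] := quotient_chart_near (@filterT _ (nbhs p0) _).
set i := qchart j; set e := coord A i p0.
have ip0 : dom A i p0 := qdom_sub jp0.
pose M := n%:R * n%:R * (`|g i e| + 1).
have M0 : 0 <= M by rewrite !mulr_ge0// addr_ge0.
have near_e : \forall v \near e, chart_image (quotient_atlas A L) j v /\
    forall u, gram (g i v) u u <= M * `|u| ^+ 2.
  have c : \forall v \near e, `|g i v| <= `|g i e| + 1.
    have ie : chart_image A i e by exists p0.
    have /cvgrPdist_le /(_ 1 ltr01) := metric_continuous ie.
    apply: filterS => v gv; rewrite -lerBlDl (le_trans (lerB_dist _ _))//.
    by rewrite distrC.
  apply: filterS2 (quotient_chart_image_near jp0) c => v iv gv; split=> // u.
  rewrite (le_trans (ler_norm _))// (le_trans (gram_norm_le _ _ _))//.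
  by rewrite expr2 mulrA !ler_wpM2r// /M ler_wpM2l// mulr_ge0.
have /nbhs_normP[rho /= rho0 Hrho] := near_e.
have N0 : 0 < 1 + M by rewrite ltr_pwDl.
pose r := Num.min rho (d / (4 * (1 + M))).
have r0 : 0 < r by rewrite lt_min rho0/= divr_gt0// mulr_gt0.
have near_p : \forall p \near p0, qdom j p /\ `|e - coord A i p| < r.
  apply: filterI; first by apply: open_nbhs_nbhs; split=> //; exact: qdom_open.
  by have /cvgrPdist_lt/(_ r r0) := Defs.coord_continuous mA ip0.
exists ([set p | qdom j p /\ `|e - coord A i p| < r],
        [set p | qdom j p /\ `|e - coord A i p| < r]) => //.
move=> [p q] [/= [jp er] [jq es]].
set v := coord A i p in er; set w := coord A i q in es.
have wv : `|w - v| < 2 * r.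
  by have := ler_distD e w v; rewrite (distrC w e); lra.
have rd : 4 * (1 + M) * r <= d.
  by rewrite mulrC -ler_pdivlMr ?mulr_gt0// ge_min lexx orbT.
have -> : coset_pi L p = param (quotient_atlas A L) j v by rewrite /= coordK//; exact: qdom_sub.
have -> : coset_pi L q = param (quotient_atlas A L) j w by rewrite /= coordK//; exact: qdom_sub.
apply: (@le_lt_trans _ _ ((1 + M) * `|w - v|)%:E).
  apply: quotient_arc_dist => [t|]; last by rewrite mulr_ge0// ltW.
  rewrite in_itv/= => /andP[t0 t1].
  have [] := Hrho (v + t *: (w - v)).
    rewrite /ball_/=.
    have -> : e - (v + t *: (w - v)) = (1 - t) *: (e - v) + t *: (e - w).
      have E1 : - (e - v) + (e - w) = - (w - v) by rewrite !opprB addrA subrK.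
      by rewrite scalerBl scale1r -addrA -scalerN -scalerDr E1 scalerN opprD addrA.
    rewrite (le_lt_trans (ler_normD _ _))// !normrZ !ger0_norm ?subr_ge0//.
    pose m := Num.max `|e - v| `|e - w|.
    have mr : m < rho.
      by apply: (@lt_le_trans _ _ r); [rewrite gt_max er es|rewrite ge_min lexx].
    have vm : `|e - v| <= m by rewrite le_max lexx.
    have wm : `|e - w| <= m by rewrite le_max lexx orbT.
    have t1' : 0 <= 1 - t by rewrite subr_ge0.
    by have := ler_wpM2l t0 wm; have := ler_wpM2l t1' vm; lra.
  move=> im Hg; split=> //; apply: le_trans (Hg _) _.
  rewrite exprMn ler_wpM2r// ?exprn_ge0//.
  by rewrite sqrrD expr1n; have := sqr_ge0 M; lra.
rewrite lte_fin; have := ltr_pM2l N0 `|w - v| (2 * r); rewrite wv => H.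
have : 0 < (1 + M) * r by exact: mulr_gt0.
by lra.
Qed.

End quotient_distance.

(** * A bump function on R^n *)

Section bump.
Context {R : realType} {n : nat}.
Implicit Types (v w e : 'rV[R]_n) (rho : R).

Definition posqr (x : R) := Num.max 0 x ^+ 2.

(** Squaring smooths the corner of the positive part. *)
Lemma is_derive_posqr (x : R) : is_derive x (1 : R) posqr (2 * Num.max 0 x).
Proof.
have bound h : `|posqr (h + x) - posqr x - h * (2 * Num.max 0 x)| <= h ^+ 2.
  rewrite /posqr ler_norml; have h2 := sqr_ge0 h; have hx2 := sqr_ge0 (h + x).
  by case: (lerP 0 (h + x)); case: (lerP 0 x) => x0 hx0; nra.
suff H : h^-1 *: (posqr (h *: (1 : R) + x) - posqr x) @[h --> (0 : R)^'] -->
    2 * Num.max 0 x.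
  by split; [apply/cvg_ex; eexists; exact: H|exact: cvg_lim].
apply/cvgrPdist_le => eps eps0; near=> h.
have h0 : h != 0 by near: h; exact: nbhs_dnbhs_neq.
have heps : `|h| <= eps by near: h; exact: dnbhs0_le.
rewrite distrC [h *: 1]mulr1.
have -> : h^-1 *: (posqr (h + x) - posqr x) - 2 * Num.max 0 x =
    h^-1 * (posqr (h + x) - posqr x - h * (2 * Num.max 0 x)).
  by rewrite [in RHS]mulrBr mulrA mulVf// mul1r.
apply: le_trans heps; rewrite normrM normfV ler_pdivrMl ?normr_gt0//.
by rewrite (le_trans (bound h))// -normrM -expr2 ger0_norm ?sqr_ge0.
Unshelve. all: by end_near. Qed.

Definition sumsq v : R := \sum_k v 0 k ^+ 2.

Lemma sumsq_coord v k : v 0 k ^+ 2 <= sumsq v.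
Proof.
rewrite /sumsq (bigD1 k)//= lerDl; apply: sumr_ge0 => j _; exact: sqr_ge0.
Qed.

Lemma sumsq_ge0 v : 0 <= sumsq v.
Proof. by apply: sumr_ge0 => j _; exact: sqr_ge0. Qed.

Definition bump rho e v : R := posqr (rho - sumsq (v - e)).

Lemma bump_support r e v : 0 <= r -> bump (r ^+ 2) e v != 0 -> `|v - e| <= r.
Proof.
move=> r0; rewrite /bump /posqr.
have [H|H _] := ltP (r ^+ 2) (sumsq (v - e)).
  by rewrite max_l ?subr_le0 ?(ltW H)// expr0n eqxx.
apply: rV_norm_le => // k; rewrite -ler_sqr ?nnegrE// -normrX ger0_norm ?sqr_ge0//.
exact: le_trans (sumsq_coord _ _) H.
Qed.

Lemma cvg_sumsq e : sumsq (v - e) @[v --> e] --> (0 : R).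
Proof.
have -> : 0 = \sum_(k < n) (0 : R) ^+ 2 by rewrite big1// => k _; rewrite expr0n.
apply: cvg_big => [||k _]; [exact: add_continuous|exact: nbhs_filter|].
have c : v 0 k - e 0 k @[v --> e] --> (0 : R).
  rewrite -[X in _ --> X](subrr (e 0 k)); apply: cvgB; last exact: cvg_cst.
  exact: matrix_normedtype.coord_continuous.
have -> : (fun v => (v - e) 0 k ^+ 2) = (fun x : R => x ^+ 2) \o (fun v => v 0 k - e 0 k).
  by apply/funext => v; rewrite /= !mxE.
exact: (cvg_comp _ (fun x : R => x ^+ 2) c (@exprn_continuous _ 2 0)).
Qed.

Lemma bump_center rho e : 0 < rho -> \forall v \near e, rho ^+ 2 / 4 < bump rho e v.
Proof.
move=> rho0; have rho2 : 0 < rho / 2 by rewrite divr_gt0.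
have /cvgrPdist_lt /(_ _ rho2) := cvg_sumsq e.
apply: filterS => v; rewrite sub0r normrN ger0_norm ?sumsq_ge0// => H.
by rewrite /bump /posqr max_r; [nra|lra].
Qed.

Lemma is_derive_coord (c : R -> 'rV[R]_n) t w k :
  is_derive t (1 : R) c w -> is_derive t (1 : R) (fun s => c s 0 k) (w 0 k).
Proof.
move=> [dc cw]; split; first exact: (derivable_mxP _ _ _).1.
by rewrite -cw derive_mx// mxE.
Qed.

(** The last clause confines the estimates to the support of the bump, the only
    place where the metric is controlled. *)
Lemma is_derive_bump rho e (c : R -> 'rV[R]_n) t w : 0 <= rho ->
  is_derive t (1 : R) c w ->
  exists d, [/\ is_derive t (1 : R) (bump rho e \o c) d,
    `|d| <= 4 * rho * (1 + rho) * n%:R * `|w| &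
    rho < sumsq (c t - e) -> d = 0].
Proof.
move=> rho0 dc.
pose q k s := c s 0 k - e 0 k.
have dq k : is_derive t (1 : R) (q k) (w 0 k).
  rewrite -[w 0 k]subr0; apply: is_deriveB; exact: is_derive_coord.
have ds : is_derive t (1 : R) (fun s => rho - sumsq (c s - e))
    (- \sum_k 2 * q k t * w 0 k).
  have -> : (fun s => rho - sumsq (c s - e)) = cst rho - \sum_k (q k ^+ 2).
    apply/funext => s; rewrite /GRing.add/GRing.opp/= /sumsq fct_sumE; congr (_ - _).
    by apply: eq_bigr => k _; rewrite !mxE.
  rewrite -[X in is_derive _ _ _ X]add0r; exact: is_deriveB.
pose p := Num.max 0 (rho - sumsq (c t - e)).
exists ((2 * p) * (- \sum_k 2 * q k t * w 0 k)); split.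
- apply: (@is_derive1_comp _ posqr (fun s => rho - sumsq (c s - e))).
  exact: is_derive_posqr.
- have [H|H] := leP rho (sumsq (c t - e)).
    by rewrite /p max_l ?subr_le0// mulr0 mul0r normr0 !mulr_ge0// addr_ge0.
  have p0 : 0 <= p <= rho.
    by rewrite /p max_r ?subr_ge0 ?(ltW H)//= lerBlDr lerDl sumsq_ge0.
  have qle k : `|q k t| <= 1 + rho.
    have := le_trans (sumsq_coord (c t - e) k) (ltW H); rewrite !mxE -/(q k t).
    by rewrite ler_norml; nra.
  have S : `|\sum_k 2 * q k t * w 0 k| <= n%:R * (2 * (1 + rho) * `|w|).
    rewrite (le_trans (ler_norm_sum _ _ _))//.
    have -> : n%:R * (2 * (1 + rho) * `|w|) = \sum_(k < n) 2 * (1 + rho) * `|w|.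
      by rewrite sumr_const card_ord mulr_natl.
    apply: ler_sum => k _; rewrite !normrM normr_nat ler_pM ?mulr_ge0 ?coord_norm_le//.
    by rewrite ler_wpM2l.
  case/andP: p0 => p0 prho.
  rewrite normrM normrN ger0_norm ?mulr_ge0//.
  have -> : 4 * rho * (1 + rho) * n%:R * `|w| = 2 * rho * (n%:R * (2 * (1 + rho) * `|w|)).
    by ring.
  by rewrite ler_pM ?mulr_ge0// ler_wpM2l.
- by move=> H; rewrite /p max_l ?subr_le0 ?(ltW H)// mulr0 mul0r.
Qed.

End bump.

(** * Lipschitz functions: lower bounds for the quotient distance *)

Section quotient_lower_bound.
Context {R : realType} {n : nat} {G : groupTopologicalType}.
Variables (A : atlas 'rV[R]_n G) (L : groupClosed G) (g : metric_tensor A).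
Hypotheses (lA : lie_group A) (discL : discrete_subgroup L).
Hypothesis cL : compact [set: coset_space L].
Hypotheses (rg : riemannian_metric g) (bg : biinvariant g).

Let mA : smooth_manifold A. Proof. by case: lA. Qed.
Let mulC := mulg_continuous lA.
Let invC := invg_continuous lA.

Lemma compact_unit_sphere : compact [set w : 'rV[R]_n | `|w| = 1].
Proof.
apply: bounded_closed_compact.
  exists 1; split=> // M M1 w /= ->; exact: ltW.
have -> : [set w : 'rV[R]_n | `|w| = 1] = (fun w : 'rV[R]_n => `|w|) @^-1` [set 1] by [].
apply: closed_comp; last exact: closed_eq.
by move=> w _; exact: norm_continuous.
Qed.

(** Positivity on the compact unit sphere persists, uniformly, for nearby
    Gram matrices; the general case follows by homogeneity. *)
Lemma metric_lower_bound (i : A) x : dom A i x ->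
  exists2 K, 0 < K & \forall v \near coord A i x, forall w,
    `|w| <= K * Num.sqrt (gram (g i v) w w).
Proof.
move=> ix; set e := coord A i x; have ie : chart_image A i e by exists x.
have cS := (compact_near_coveringP _).1 compact_unit_sphere.
have : \forall kv \near filter_prod (0 : R)^'+ (nbhs e),
    [set w : 'rV[R]_n | `|w| = 1] `<=` (fun w => kv.1 < gram (g i kv.2) w w).
  apply: (cS _ _ (fun kv w => kv.1 < gram (g i kv.2) w w)) => w /= w1.
  have w0 : w != 0 by rewrite -normr_gt0 w1.
  have gam0 := metric_pos rg ie w0; set gam := gram _ w w in gam0.
  have gam2 : 0 < gam / 2 by rewrite divr_gt0.
  have c : gram (g i t.2.2) t.1 t.1 @[t --> filter_prod (nbhs w) (filter_prod (0 : R)^'+ (nbhs e))]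
      --> gam.
    apply: cvg_gram; [|exact: cvg_fst|exact: cvg_fst].
    apply: (cvg_comp _ (g i)); last exact: (metric_continuous rg ie).
    by apply: cvg_comp cvg_snd cvg_snd.
  have H1 := (cvgrPdist_lt _ _).1 c _ gam2.
  have H2 : \forall t \near filter_prod (nbhs w) (filter_prod (0 : R)^'+ (nbhs e)),
      t.2.1 < gam / 2.
    have c1 : t.2.1 @[t --> filter_prod (nbhs w) (filter_prod (0 : R)^'+ (nbhs e))] --> (0 : R)^'+.
      by apply: cvg_comp cvg_snd cvg_fst.
    exact: (c1 _ (nbhs_right_lt gam2)).
  have FF : Filter (filter_prod (nbhs w) (filter_prod (0 : R)^'+ (nbhs e))) by exact: _.
  apply: (@filterS2 _ _ FF _ _ _ _ (H1 FF) H2) => t.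
  by rewrite ltr_norml; lra.
move=> [[U V] [/= U0 Ve] UV].
have [k [Uk k0]] : exists k, U k /\ 0 < k.
  near (0 : R)^'+ => k; exists k; split; first by near: k.
  by [].
exists (Num.sqrt k)^-1; first by rewrite invr_gt0 sqrtr_gt0.
apply: filterS Ve => v Vv w.
have [->|w0] := eqVneq w 0; first by rewrite normr0 mulr_ge0// ?invr_ge0 sqrtr_ge0.
have nw : 0 < `|w| by rewrite normr_gt0.
have := UV (k, v) (conj Uk Vv) (`|w|^-1 *: w) _.
rewrite /= normrZ normfV normr_id mulVf ?gt_eqF// => /(_ erefl).
rewrite gramZ exprVn ltr_pdivlMl ?exprn_gt0// => H.
rewrite ler_pdivlMl ?sqrtr_gt0// -(ger0_norm (ltW nw)) -sqrtr_sqr -sqrtrM ?(ltW k0)//.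
by apply: ler_wsqrtr; rewrite mulrC; exact: ltW.
Unshelve. all: by end_near. Qed.

(** Right translations are isometries, so a curve and its translate have the
    same speed, even when read in different charts. *)
Lemma translated_curve (i k : A) (a : G) (c : R -> 'rV[R]_n) t w :
  chart_image A i (c t) -> dom A k (param A i (c t) * a)%g ->
  is_derive t (1 : R) c w ->
  exists2 w', is_derive t (1 : R) (fun s => coord A k (param A i (c s) * a)%g) w' &
    gram (g k (coord A k (param A i (c t) * a)%g)) w' w' = gram (g i (c t)) w w.
Proof.
move=> ict kca dc; have [x ix xc] := ict.
have px : param A i (c t) = x by rewrite -xc (coordK mA).
have [j ja] := chart_cover mA a.
have kxa : dom A k (x * a)%g by rewrite -px.
have [P [Q H]] := mul_strict_derivative lA ix ja kxa.
pose T (v : 'rV[R]_n) : 'rV[R]_n := coord A k (param A i v * a)%g.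
have TP (eta : R) : 0 < eta ->
    \forall y \near c t, `|T y - T (c t) - (y - c t) *m P| <= eta * `|y - c t|.
  move=> /H[rho rho0 Hrho]; apply/nbhs_normP; exists rho => //= y.
  rewrite /ball_/= distrC => yc.
  have := Hrho (c t, coord A j a) (y, coord A j a).
  rewrite -xc /mul_in_charts/= !(coordK mA ja) !prod_normE/= !subrr normr0 mul0mx addr0.
  by rewrite xc !max_l//; apply.
exists (w *m P); first exact: (is_derive_strict TP dc).
have := (bg a).2 i k x ix kxa w w.
rewrite xc px => <-.
by rewrite -(derive_strict w TP).
Qed.

Lemma path_increment (F : coset_space L -> R) (K : R) :
  (forall (k : quotient_chart A L) (c : R -> 'rV[R]_n) t,
     (forall t, derivable c t 1) -> chart_image (quotient_atlas A L) k (c t) ->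
     exists2 d, is_derive t (1 : R) (fun s => F (param (quotient_atlas A L) k (c s))) d &
       `|d| <= K * Num.sqrt (gram (g (qchart k) (c t)) (derive1 c t) (derive1 c t))) ->
  forall x y l, path_length (quotient_metric L g) x y l -> `|F x - F y| <= K * l.
Proof.
move=> HF x y l; elim=> {x y l} [x|x y z l l' arc _ IH].
  by rewrite subrr normr0 mulr0.
rewrite mulrDr (le_trans (ler_distD (F y) _ _))// lerD// {IH}.
case: arc => k c dc cc' imc; rewrite distrC.
apply: (@increment_le_Rintegral R _ (fun s => F (param (quotient_atlas A L) k (c s)))).
  move=> t t01; apply: (speed_continuous rg dc cc').
  have /quotient_chart_imageP[p jp pc] := imc t t01.
  by exists p => //; exact: qdom_sub jp.
by move=> t t01; apply: HF => //; exact: imc.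
Qed.


(** The function is a bump in one chart of the quotient, extended by 0. Along a
    curve of the quotient there are two cases at each time. Either a lift of the
    curve is, after translation by an element of [L], in the domain of the chart:
    then the speed controls the derivative of the bump. Or it is away from the
    saturation of the support, which is closed, and the function vanishes near
    that time. *)
Lemma lipschitz_bump (p0 : G) (N : set G) : nbhs p0 N ->
  exists (F : coset_space L -> R) (K m : R), [/\ 0 < m, 0 <= K,
    \forall p \near p0, m < F (coset_pi L p),
    forall q, F q != 0 -> exists2 y, N y & coset_pi L y = q &
    forall x y l, path_length (quotient_metric L g) x y l -> `|F x - F y| <= K * l].
Proof.
move=> Np0; have [U Up0 clU] := closed_saturation mulC invC discL p0.
have [j jp0 jN] := quotient_chart_near lA discL cL (filterI Np0 Up0).
set k := qchart j; set e := coord A k p0.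
have kp0 : dom A k p0 := qdom_sub jp0.
have [K0 K00 HK0] := metric_lower_bound kp0.
have near_e : \forall v \near e, chart_image (quotient_atlas A L) j v /\
    forall w, `|w| <= K0 * Num.sqrt (gram (g k v) w w).
  by apply: filterS2 (quotient_chart_image_near lA jp0) HK0.
have /nbhs_normP[r0 /= r00 Hr0] := near_e.
pose r := r0 / 2; have r_gt0 : 0 < r by rewrite divr_gt0.
have rr0 : r < r0 by rewrite /r; lra.
have near_r v : `|v - e| <= r -> exists2 x, qdom j x & coord A k x = v /\
    forall w, `|w| <= K0 * Num.sqrt (gram (g k v) w w).
  move=> vr; have [|/quotient_chart_imageP[x jx xv] Hv] := Hr0 v.
    by rewrite /ball_/= distrC; exact: le_lt_trans rr0.
  by exists x.
pose C : set G := param A k @` closed_ball_ Num.norm e r.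
have CE y : C y <-> qdom j y /\ `|coord A k y - e| <= r.
  split=> [[v]|[jy yr]].
    rewrite /closed_ball_/= distrC => vr <-; have [x jx [xv _]] := near_r v vr.
    by rewrite -xv (coordK mA (qdom_sub jx)) -/k xv.
  exists (coord A k y); first by rewrite /closed_ball_/= distrC.
  by rewrite (coordK mA (qdom_sub jy)).
have clC : closed C.
  apply: compact_closed; first exact: manifold_hausdorff mA.
  apply: continuous_compact.
    apply: continuous_in_subspaceT => v; rewrite inE /closed_ball_/= distrC => vr.
    have [x jx [xv _]] := near_r v vr.
    apply: (param_continuous mA); exists x => //; exact: qdom_sub jx.
  apply: bounded_closed_compact; last exact: closed_closed_ball_.
  exists (`|e| + r); split=> [|M eM v]; first exact: num_real.
  rewrite /closed_ball_/= => vr.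
  have := ler_normB e (e - v); rewrite opprB addrC subrK => H.
  by rewrite (le_trans H)// (le_trans _ (ltW eM))// lerD2l.
have CU : C `<=` U by move=> y /CE[/jN[]].
have sat := clU C CU clC.
pose b := bump (r ^+ 2) e.
pose F q := if `[< (coset_pi L @` qdom j) q >]
  then b (coord (quotient_atlas A L) j q) else 0.
have Fin x : qdom j x -> F (coset_pi L x) = b (coord A k x).
  move=> jx; rewrite /F asboolT; last by exists x.
  by rewrite /= qsectionK.
have Fsupp x : F (coset_pi L x) != 0 -> exists2 a, a \in L & C (x * a)%g.
  rewrite /F; case: asboolP => [[y jy yx]|]; last by rewrite eqxx.
  rewrite -yx /= qsectionK// => by0.
  exists (x^-1 * y)%g; first exact/coset_piP.
  by rewrite mulVKg; apply/CE; split=> //; apply: bump_support by0; exact: ltW.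
pose K1 := 4 * r ^+ 2 * (1 + r ^+ 2) * n%:R.
have r2 : 0 <= r ^+ 2 by exact: sqr_ge0.
have r21 : 0 <= 1 + r ^+ 2 by exact: addr_ge0.
have K10 : 0 <= K1 by do 3 (apply: mulr_ge0 => //).
exists F, (K1 * K0), ((r ^+ 2) ^+ 2 / 4); split.
- by rewrite divr_gt0// !exprn_gt0.
- by rewrite mulr_ge0// ltW.
- have cb := bump_center e (exprn_gt0 2 r_gt0).
  have cc : coord A k p @[p --> p0] --> e := Defs.coord_continuous mA kp0.
  have H1 : \forall p \near p0, (r ^+ 2) ^+ 2 / 4 < b (coord A k p) := cc _ cb.
  have H2 : \forall p \near p0, qdom j p.
    by apply: open_nbhs_nbhs; split=> //; exact: qdom_open.
  by apply: filterS2 H1 H2 => p bp jp; rewrite Fin.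
- move=> q; have [x <-] := coset_pi_surj q => /Fsupp[a aL /CE[/jN[Nxa _] _]].
  by exists (x * a)%g => //; exact: coset_pi_mulr.
apply: path_increment => i c t dc /quotient_chart_imageP[x ix xc].
have ict : chart_image A (qchart i) (c t) by exists x => //; exact: qdom_sub ix.
have ct : c s @[s --> t] --> c t.
  by apply: differentiable_continuous; exact/derivable1_diffP.
pose z s := param A (qchart i) (c s).
have cz : z s @[s --> t] --> z t.
  exact: (cvg_comp _ (param A (qchart i)) ct (param_continuous mA ict)).
have [[a aL ja]|out] := pselect (exists2 a, a \in L & qdom j (z t * a)%g).
  have near_j : \forall s \near t, qdom j (z s * a)%g.
    have : (z s * a)%g @[s --> t] --> (z t * a)%g.
      by apply: cvg_mulg => //; exact: cvg_cst.
    by apply; apply: open_nbhs_nbhs; split=> //; exact: qdom_open.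
  have dct : is_derive t (1 : R) c (derive1 c t) by rewrite derive1E; exact: derivableP.
  have [w' dw' gw'] := translated_curve ict (qdom_sub ja) dct.
  have [d [dd dle dsupp]] := is_derive_bump e r2 dw'.
  exists d.
    apply: near_eq_is_derive dd.
    apply: filterS near_j => s js /=.
    by rewrite -/(z s) -[RHS](congr1 F (coset_pi_mulr (z s) aL)) Fin.
  have [S|S] := ltP (r ^+ 2) (sumsq (coord A k (z t * a)%g - e)).
    by rewrite dsupp// normr0 mulr_ge0 ?sqrtr_ge0// mulr_ge0// ltW.
  rewrite (le_trans dle)// -/K1 -(mulrA K1 K0) ler_wpM2l//.
  rewrite -gw'.
  have [|y jy [yv Hv]] := near_r (coord A k (z t * a)%g); last exact: Hv.
  apply: rV_norm_le => [|l]; first exact: ltW.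
  rewrite -ler_sqr ?nnegrE ?(ltW r_gt0)// -normrX ger0_norm ?sqr_ge0//.
  exact: le_trans (sumsq_coord _ _) S.
exists 0; last by rewrite normr0 mulr_ge0 ?sqrtr_ge0// mulr_ge0// ltW.
have outC : ~ exists2 a, a \in L & C (z t * a)%g.
  by move=> [a aL /CE[ja _]]; apply: out; exists a.
have near_out : \forall s \near t, ~ exists2 a, a \in L & C (z s * a)%g := cz _ (sat _ outC).
apply: near_eq_is_derive (is_derive_cst 0 t 1).
apply: filterS near_out => s nC /=; apply/esym/eqP/negPn/negP => /Fsupp.
exact: nC.
Qed.

(** The bump function is large at [pi p] and Lipschitz, so it cannot vanish at a
    close point [pi q]; hence [q] can be chosen in a small neighbourhood of [p]. *)
Lemma quotient_dist_lower_bound (B : set G) : nbhs 1%g B ->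
  \forall eps \near (0 : R)^'+, forall p q : G,
    (riemannian_dist (quotient_metric L g) (coset_pi L q) (coset_pi L p) < eps%:E)%E ->
    exists2 h, B h & coset_pi L q = coset_pi L (h * p)%g.
Proof.
move=> B1.
apply: (@compact_coset_uniform _ L mulC _ (0 : R)^'+ _ (fun eps p => forall q : G,
    (riemannian_dist (quotient_metric L g) (coset_pi L q) (coset_pi L p) < eps%:E)%E ->
    exists2 h, B h & coset_pi L q = coset_pi L (h * p)%g)) => //.
  move=> eps p a aL H q; rewrite coset_pi_mulr// => /H[h Bh hp].
  by exists h => //; rewrite mulgA coset_pi_mulr.
move=> p0.
have : (fun x : G * G => x.1 * x.2^-1)%g @ (p0, p0) --> (p0 * p0^-1)%g.
  apply: cvg_mulg => //; first exact: cvg_fst.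
  by apply: cvg_invg => //; exact: cvg_snd.
rewrite mulgV => /(_ _ B1)[[N1 N2] [/= N1p N2p] NB].
have [F [K [m [m0 K0 Fp0 Fsupp Flip]]]] := lipschitz_bump N1p.
exists ([set p | N2 p /\ m < F (coset_pi L p)], [set eps | K * eps < m]).
  split => /=; first exact: filterI.
  have [->|Kn0] := eqVneq K 0.
    by apply: nearW => eps /=; rewrite mul0r.
  have K1 : 0 < K by rewrite lt_neqAle eq_sym Kn0.
  have mK : 0 < m / K by rewrite divr_gt0.
  by apply: filterS (nbhs_right_lt mK) => eps /=; rewrite ltr_pdivlMr// mulrC.
move=> [p eps] [/= [N2p' Fp] Ke] q /ereal_inf_lt[_ [l pl <-]].
rewrite lte_fin => leps.
have Fq : F (coset_pi L q) != 0.
  apply/eqP => Fq0; have := Flip _ _ _ pl; rewrite Fq0 sub0r normrN.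
  have := ler_wpM2l K0 (ltW leps); have := ler_norm (F (coset_pi L p)); lra.
have [y N1y yq] := Fsupp _ Fq; exists (y * p^-1)%g; first exact: (NB (y, p)).
by rewrite mulgVK.
Qed.

End quotient_lower_bound.

(** * Entropy *)

Section entropy_of_bounded_spanning.
Context {R : realType} {M : Type} (d : M -> M -> \bar R) (f : M -> M).
Local Open Scope ereal_scope.

Lemma spanning_number_ge1 t (B : set M) (delta : R) :
  B !=set0 -> 1 <= spanning_number d f t B delta.
Proof.
move=> [x Bx]; apply: le_ereal_inf_tmp => _ [k [K Kk sK] <-].
rewrite lee_fin ler1n lt0n; apply/eqP => k0; move: Kk.
rewrite k0 II0 card_eq0 => /eqP K0.
by have [y] := sK x Bx; rewrite K0.
Qed.

Lemma spanning_number_le_card t (B : set M) (delta : R) (m : nat) (y : nat -> M) :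
  (forall x, B x -> exists2 i, (i < m)%N &
    forall j, (j < t)%N -> d (iter j f x) (iter j f (y i)) < delta%:E) ->
  spanning_number d f t B delta <= m%:R%:E.
Proof.
move=> H; set K := y @` `I_m.
have /finite_set_leP[k0 _] : finite_set K by exact: finite_image.
have [k Kk] : finite_set K by exact: finite_image.
apply: (@le_trans _ _ k%:R%:E).
  apply: ereal_inf_lbound; exists k => //; exists K => // x /H[i im xi].
  by exists (y i) => //; exists i.
rewrite lee_fin ler_nat -card_le_II -(card_le_eql Kk).
exact: card_image_le.
Qed.

(** The spanning number of a nonempty set is at least 1, so its logarithm lies
    between 0 and a constant, and is killed by the division by [t]. *)
Lemma local_entropy_eq0 (eps : R) : (exists x : M, True) ->
  (forall x, d x x < eps%:E) ->
  (forall delta : R, (0 < delta)%R -> exists C : nat, forall t x, (0 < t)%N ->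
    spanning_number d f t (bowen_ball d f t x eps) delta <= C%:R%:E) ->
  local_entropy d f eps = 0.
Proof.
move=> [x0 _] dxx H.
suff at0 delta : (0 < delta)%R -> local_entropy_at d f eps delta = 0.
  apply: (@lim_near_cst (\bar R)); first exact: ereal_hausdorff.
  near=> delta; apply: at0; near: delta; exact: nbhs_right_gt.
move=> /H[C HC].
have S1 t : 1 <= ereal_sup
    [set spanning_number d f t (bowen_ball d f t x eps) delta | x in [set: M]].
  apply: le_trans (_ : spanning_number d f t (bowen_ball d f t x0 eps) delta <= _).
    by apply: spanning_number_ge1; exists x0 => i _; exact: dxx.
  by apply: ereal_sup_ubound; exists x0.
have SC t : (0 < t)%N ->
    ereal_sup [set spanning_number d f t (bowen_ball d f t x eps) delta | x in [set: M]] <= C%:R%:E.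
  by move=> t0; apply: ge_ereal_sup => _ [x _ <-]; exact: HC.
have C1 : (1 <= C%:R :> R)%R by have := le_trans (S1 1%N) (SC 1%N isT); rewrite lee_fin.
suff cv : (fun t : nat => (t%:R^-1)%:E * lne (ereal_sup
    [set spanning_number d f t (bowen_ball d f t x eps) delta | x in [set: M]])) @ \oo --> 0%E.
  by have [_] := cvg_limn_einf_sup cv.
apply: (@squeeze_cvge _ _ _ _ (cst 0) _ (fun t => (t%:R^-1 * ln C%:R)%:E)).
- near=> t; have t0 : (0 < t)%N by near: t; exists 1%N.
  rewrite mule_ge0 ?lee_fin ?invr_ge0// ?lne_ge0//= EFinM.
  apply: lee_wpmul2l; first by rewrite lee_fin invr_ge0.
  have C0 : (0 < C%:R :> R)%R by exact: lt_le_trans C1.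
  rewrite -lne_EFin// lee_lne ?SC// in_itv/= leey andbT ?lee_fin ?(ltW C0)//.
  exact: le_trans (S1 t).
- exact: cvg_cst.
- apply: cvg_EFin; first exact: nearW.
  rewrite -[X in _ --> X](mul0r (ln C%:R)).
  apply: cvgMr_tmp; apply/gtr0_cvgV0.
    by near=> t; rewrite ltr0n; near: t; exists 1%N.
  exact: cvgr_idn.
Unshelve. all: by end_near. Qed.

End entropy_of_bounded_spanning.

Section quotient_endomorphisms.
Context {R : realType} {n : nat} {G : groupTopologicalType}.
Variables (A : atlas 'rV[R]_n G) (L : groupClosed G) (g : metric_tensor A).
Hypotheses (lA : lie_group A) (discL : discrete_subgroup L).
Hypothesis cL : compact [set: coset_space L].
Hypotheses (rg : riemannian_metric g) (bg : biinvariant g).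
Local Notation dist := (riemannian_dist (quotient_metric L g)).

Lemma quotient_dist_upper_bound (delta : R) : 0 < delta ->
  \forall h \near (1%g : G), forall p : G,
    (dist (coset_pi L (h * p)%g) (coset_pi L p) < delta%:E)%E.
Proof.
move=> delta0; have mulC := mulg_continuous lA.
apply: (@compact_coset_uniform _ L mulC _ (nbhs (1%g : G)) _ (fun h p =>
    (dist (coset_pi L (h * p)%g) (coset_pi L p) < delta%:E)%E)) => //.
  by move=> h p a aL dhp; rewrite mulgA !(coset_pi_mulr _ aL).
move=> p0.
have [[N1 N2] [/= N1p N2p] Nd] := quotient_dist_near lA discL cL rg p0 delta0.
have : (fun x : G * G => x.2 * x.1)%g @ (p0, 1%g) --> (1 * p0)%g.
  by apply: cvg_mulg => //; [exact: cvg_snd|exact: cvg_fst].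
rewrite mul1g => /(_ _ N1p)[[U V] [/= Up V1] UV].
exists (U `&` N2, V); first by split=> //; exact: filterI.
move=> [p h] [/= [Up' N2p'] Vh]; apply: (Nd ((h * p)%g, p)).
by split=> //; exact: (UV (p, h)).
Qed.

End quotient_endomorphisms.

Theorem theorem10 (R : realType) (n : nat) (G : groupTopologicalType)
    (A : atlas 'rV[R]_n G) (L : groupClosed G) (g : metric_tensor A)
    (phi : coset_space L -> coset_space L) :
  lie_group A ->
  discrete_subgroup L ->
  compact [set: coset_space L] ->
  riemannian_metric g ->
  biinvariant g ->
  quotient_endomorphism A phi ->
  h_expansive (riemannian_dist (quotient_metric L g)) phi.
Proof.
move=> lA discL cL rg bg [a [Phi [[cPhi _] _ phiE]]].
have mA : smooth_manifold A by case: lA.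
have mulC := mulg_continuous lA; have invC := invg_continuous lA.
pose psi h := (a * Phi h * a^-1)%g; pose psit p := (a * Phi p)%g.
have psiM : {morph psi : x y / (x * y)%g}.
  by move=> x y; rewrite /psi gmulfM !mulgA mulgVK.
have psitM h p : psit (h * p)%g = (psi h * psit p)%g.
  by rewrite /psi /psit gmulfM !mulgA mulgVK.
have iter_psit i h p : iter i psit (h * p)%g = (iter i psi h * iter i psit p)%g.
  by elim: i => [//|i IH] /=; rewrite IH psitM.
have iter_phi i p : iter i phi (coset_pi L p) = coset_pi L (iter i psit p).
  by elim: i => [//|i IH] /=; rewrite IH phiE.
have psi1 : psi 1%g = 1%g by apply: (mulgI (psi 1%g)); rewrite -psiM !mulg1.
have cpsi : {for 1%g, continuous psi}.
  apply: (@cvg_mulg _ mulC); last exact: cvg_cst.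
  by apply: (@cvg_mulg _ mulC); [exact: cvg_cst|exact: cPhi].
have [i1 i11] := chart_cover mA (1%g : G).
have [r lc] := lie_group_near_linear_coords lA i11.
set D := dom A i1 in lc; set u := (fun h => _) in lc.
have r0 := nlc_radius lc.
have [[N1 N2] [/= N11 N21] N12] := coset_pi_inj_near mulC invC discL cL.
have near_psi U : nbhs (1%g : G) U -> \forall h \near (1%g : G), U (psi h).
  by move=> U1; apply: cpsi; rewrite psi1.
have near_inv U : nbhs (1%g : G) U -> \forall h \near (1%g : G), U h^-1%g.
  by move=> U1; apply: invC; rewrite invg1.
have Br := nlc_nbhs lc r0.
have [e e0 He] := nlc_base lc (filterI (filterI (near_psi _ Br) (near_inv _ Br))
  (filterI (near_psi _ N11) N21)).
pose eps := Num.min e r / 4.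
have m0 : 0 < Num.min e r by rewrite lt_min e0.
have eps0 : 0 < eps by rewrite divr_gt0.
have eps4 : 4 * eps = Num.min e r by rewrite /eps mulrC divfK.
have eps_r : 4 * eps <= r by rewrite eps4 ge_min lexx orbT.
have He4 h : coord_ball D u (4 * eps) h ->
    [/\ coord_ball D u r (psi h), coord_ball D u r h^-1%g, N1 (psi h) & N2 h].
  move=> [Dh uh]; have [|[? ?] [? ?]] := He h; last by split.
  by split=> //; apply: lt_le_trans uh _; rewrite eps4 ge_min lexx.
have He1 h : coord_ball D u eps h -> coord_ball D u (4 * eps) h.
  by move=> [Dh uh]; split=> //; apply: lt_le_trans uh _; rewrite ler_peMl ?ler1n// ltW.
have eps_psi h : coord_ball D u (4 * eps) h -> coord_ball D u r (psi h) by case/He4.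
have eps_inv h : coord_ball D u (4 * eps) h -> coord_ball D u r h^-1%g by case/He4.
have [epsQ [epsQ0 HQ]] : exists epsQ : R, 0 < epsQ /\ forall p q : G,
    (riemannian_dist (quotient_metric L g) (coset_pi L q) (coset_pi L p) < epsQ%:E)%E ->
    exists2 h, coord_ball D u eps h & coset_pi L q = coset_pi L (h * p)%g.
  have H := quotient_dist_lower_bound lA discL cL rg bg (nlc_nbhs lc eps0).
  near (0 : R)^'+ => epsQ; exists epsQ; split; first by [].
  by near: epsQ.
exists epsQ => //; apply: local_entropy_eq0.
- by exists (coset_pi L 1%g).
- move=> x; apply: le_lt_trans (_ : 0%:E < _)%E; last by rewrite lte_fin.
  by apply: ereal_inf_lbound; exists 0 => //; exact: PathNil.
move=> delta delta0.
have [d d0 Hd] := nlc_base lc (quotient_dist_upper_bound lA discL cL rg delta0).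
have [C HC] := bowen_nbhd_cover lc psiM cpsi eps0 eps_r eps_psi eps_inv d0.
exists C => t x t0; have [p <-] := coset_pi_surj x.
have [M [k [MC Wk cov]]] := HC t t0.
apply: (@le_trans _ _ M%:R%:E); last by rewrite lee_fin ler_nat.
apply: (@spanning_number_le_card _ _ _ _ _ _ _ _ (fun j => coset_pi L (k j * p)%g)) => y By.
have [q qy] := coset_pi_surj y.
have ball_lift j : (j < t)%N -> exists2 h, coord_ball D u eps h &
    iter j phi y = coset_pi L (h * iter j psit p)%g.
  move=> jt; have := By j jt; rewrite -qy !iter_phi; exact: HQ.
have [h Bh yh] := ball_lift 0%N t0; rewrite /= in yh.
have Wh : bowen_nbhd psi D u t eps h.
  elim=> [_//|j IH] jt; have Bj := IH (ltnW jt).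
  have [h' Bh' E] := ball_lift _ jt.
  have [_ _ N1h _] := He4 _ (He1 _ Bj); have [_ _ _ N2h'] := He4 _ (He1 _ Bh').
  suff -> : iter j.+1 psi h = h' by [].
  apply: (N12 (iter j.+1 psi h, h')%g _ (iter j.+1 psit p)); first by split.
  by rewrite -iter_psit -iter_phi -yh.
have [j jM Wj] := cov h Wh; exists j => // i it.
rewrite yh !iter_phi !iter_psit.
have -> : iter i psi h = (iter i psi (h * (k j)^-1) * iter i psi (k j))%g.
  have iterM : {morph iter i psi : x y / (x * y)%g}.
    by elim: (i) => [//|i' IH] v w /=; rewrite IH psiM.
  by rewrite -iterM mulgVK.
rewrite -mulgA; exact: Hd (Wj i it) _.
Unshelve. all: by end_near. Qed.
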